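(* Let $(M,J)$ be an almost complex manifold. Then every point $p\in M$ has a basis of complete hyperbolic neighborhoods; that is, for every neighborhood $W$ of $p$ in $M$ there is an open neighborhood $U\subset W$ of $p$ such that $(U,J|_U)$ is complete hyperbolic.
   Context: An almost complex manifold $(M,J)$ is a smooth manifold of even real dimension with a smooth bundle endomorphism $J$ of $TM$ satisfying $J^2=-\mathrm{Id}$. $\Delta\subset\mathbb C$ is the open unit disc with coordinate $\zeta=x+iy$ and standard complex structure $J_{st}$. A smooth map $f:\Delta\to M$ is a $J$-holomorphic disc if $df\circ J_{st}=J\circ df$. Kobayashi-Royden infinitesimal pseudometric: for $p\in M$, $v\in T_pM$, $K_{(M,J)}(p,v)$ is the infimum of all $\alpha>0$ such that there is a $J$-holomorphic disc $f:\Delta\to M$ with $f(0)=p$ and $df(0)(\partial/\partial x)=v/\alpha$. $d^K_{(M,J)}$ denotes the integrated pseudodistance of $K_{(M,J)}$: $d^K_{(M,J)}(p,q)$ is the infimum over piecewise smooth curves $\gamma:[0,1]\to M$ from $p$ to $q$ of $\int_0^1K_{(M,J)}(\gamma(t),\gamma'(t))\,dt$ (it coincides with the usual Kobayashi pseudodistance defined by chains of $J$-holomorphic discs). $(M,J)$ is complete hyperbolic if for every $p\in M$ and every $r\ge 0$ the Kobayashi ball $\{q\in M: d^K_{(M,J)}(p,q)<r\}$ is relatively compact in $M$. For an open set $U\subset M$, complete hyperbolicity of $U$ means complete hyperbolicity of the almost complex manifold $(U,J|_U)$. *)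

(* Defs.v *)
From HB Require Import structures.
From mathcomp Require Import all_boot all_order all_algebra.
From mathcomp Require Import all_classical all_reals all_analysis.

Set Implicit Arguments.
Unset Strict Implicit.
Unset Printing Implicit Defensive.

Import Order.TTheory GRing.Theory Num.Theory.
Import numFieldNormedType.Exports.

Local Open Scope classical_set_scope.
Local Open Scope ring_scope.

Section SmoothFunctions.
Context {R : realType} {V W : normedModType R}.

(* Only used for D open in a finite-dimensional V, where this is the usual
   class C^k; the values of f outside D are then irrelevant. *)
Fixpoint Ck (k : nat) (D : set V) (f : V -> W) : Prop :=
  match k with
  | 0%N => forall x, D x -> {for x, continuous f}
  | k'.+1 => (forall x, D x -> differentiable f x) /\
             (forall v : V, Ck k' D (fun x => 'D_v f x))
  end.

Definition smooth_on (D : set V) (f : V -> W) : Prop := forall k, Ck k D f.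

Lemma near_eq_differentiable (f g : V -> W) (x : V) :
  (\forall y \near x, f y = g y) -> differentiable f x -> differentiable g x.
Proof.
move=> fg dfx; have /diff_locallyP [cd ed] := dfx.
have fgx : f x = g x by exact: nbhs_singleton fg.
have eg : g \o shift x = cst (g x) + 'd f x +o_ 0 id.
  apply/eqaddoP => e e0; move/eqaddoP: ed => /(_ e e0) ed.
  have fg0 : \forall h \near 0, f (h + x) = g (h + x).
    by move: fg; rewrite (near_shift 0) /= subr0.
  apply: filterS2 fg0 ed => h E.
  by rewrite /= !fctE /= E fgx.
by apply/diff_locallyP; rewrite (diff_unique cd eg).
Qed.

(* 'd applied to a vector, with the structures of V and W fixed once and for
   all: unification on the bare 'd f x at matrix types can diverge. *)
Definition diff_at (f : V -> W) (x w : V) : W := 'd f x w.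

Lemma near_eq_diff_at (f g : V -> W) (x w : V) :
  (\forall y \near x, f y = g y) -> differentiable f x ->
  diff_at f x w = diff_at g x w.
Proof.
move=> fg df; have dg := near_eq_differentiable fg df.
rewrite /diff_at -(deriveE w df) -(deriveE w dg); exact: near_eq_derive.
Qed.

Lemma Ck_sub_eq k (D D' : set V) (f g : V -> W) : open D' -> D' `<=` D ->
  (forall x, D' x -> f x = g x) -> Ck k D f -> Ck k D' g.
Proof.
move=> oD' sD.
have nearfg (h h' : V -> W) x : D' x -> (forall x, D' x -> h x = h' x) ->
    \forall y \near x, h y = h' y.
  by move=> D'x hh'; apply: filterS hh' _; apply: open_nbhs_nbhs.
elim: k f g => [|k IH] f g fg /=.
  move=> cf x D'x; rewrite /prop_for /continuous_at -(fg x D'x).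
  apply: cvg_trans (cf x (sD _ D'x)); apply: near_eq_cvg.
  by apply: nearfg D'x _ => y D'y; rewrite fg.
move=> [df Df]; split=> [x D'x|v].
  exact: near_eq_differentiable (nearfg _ _ _ D'x fg) (df _ (sD _ D'x)).
apply: IH (Df v) => x D'x; apply: near_eq_derive; exact: nearfg D'x fg.
Qed.

Lemma smooth_on_sub_eq (D D' : set V) (f g : V -> W) : open D' -> D' `<=` D ->
  (forall x, D' x -> f x = g x) -> smooth_on D f -> smooth_on D' g.
Proof. by move=> oD' sD fg sf k; exact: Ck_sub_eq (sf k). Qed.

End SmoothFunctions.

Lemma diff_at_comp {R : realType} {U V W : normedModType R} (f : U -> V)
    (g : V -> W) (x w : U) :
  differentiable f x -> differentiable g (f x) ->
  diff_at (g \o f) x w = diff_at g (f x) (diff_at f x w).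
Proof. by move=> df dg; rewrite /diff_at diff_comp. Qed.

(* The map g o (phi|_D)^-1 on phi(D), extended by 0, for phi injective on D. *)
Definition chart_rep (M : Type) (E : Type) (W : zmodType)
    (D : set M) (phi : M -> E) (g : M -> W) (y : E) : W :=
  if pselect (exists2 x, D x & phi x = y) is left h then g (s2val (cid2 h))
  else 0.

Lemma chart_repE (M E : Type) (W : zmodType) (D : set M) (phi : M -> E)
    (g : M -> W) (x : M) :
  (forall x x', D x -> D x' -> phi x = phi x' -> x = x') -> D x ->
  chart_rep D phi g (phi x) = g x.
Proof.
move=> inj Dx; rewrite /chart_rep; case: pselect => [h|]; last by case; exists x.
by case: (cid2 h) => y Dy /= e; rewrite (inj _ _ Dy Dx e).
Qed.

(* A smooth manifold of dimension m, given by a smooth atlas.  The chart maps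
   are total functions, but only their restrictions to chart_dom i matter:
   these are homeomorphisms onto open subsets of R^m. *)
Record smoothManifold (R : realType) (m : nat) := SmoothManifold {
  manifold_sort :> topologicalType ;
  manifold_hausdorff : hausdorff_space manifold_sort ;
  manifold_second_countable : @second_countable manifold_sort ;
  chart_index : Type ;
  chart_dom : chart_index -> set manifold_sort ;
  chart_map : chart_index -> manifold_sort -> 'cV[R]_m ;
  chart_cover : forall p, exists i, chart_dom i p ;
  chart_dom_open : forall i, open (chart_dom i) ;
  chart_continuous : forall i p,
    chart_dom i p -> {for p, continuous (chart_map i)} ;
  chart_inj : forall i p q, chart_dom i p -> chart_dom i q ->
    chart_map i p = chart_map i q -> p = q ;
  chart_open : forall i (A : set manifold_sort),
    open A -> A `<=` chart_dom i -> open (chart_map i @` A) ;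
  chart_compatible : forall i j,
    smooth_on (chart_map i @` (chart_dom i `&` chart_dom j))
      (chart_rep (chart_dom i) (chart_map i) (chart_map j)) }.

Arguments chart_index {R m} M : rename.
Arguments chart_dom {R m M} i : rename.
Arguments chart_map {R m M} i : rename.

Section Tangent.
Context {R : realType} {m : nat} (M : smoothManifold R m).

Definition transition (i j : chart_index M) : 'cV[R]_m -> 'cV[R]_m :=
  chart_rep (chart_dom i) (chart_map i) (chart_map j).

(* A tangent vector at p is the family of its components in the charts around
   p, related by the differentials of the transition maps; the components in
   the other charts are set to 0, so that equality in T_pM is equality of
   families. *)
Definition tangent_family : Type := chart_index M -> 'cV[R]_m.

Definition tangent_space (p : M) : set tangent_family :=
  [set v | (forall i, ~ chart_dom i p -> v i = 0) /\
    (forall i j, chart_dom i p -> chart_dom j p ->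
       v j = diff_at (transition i j) (chart_map i p) (v i))].

(* For D open; as for Ck, the values of f outside D are irrelevant. *)
Definition smooth_map {V : normedModType R} (D : set V) (f : V -> M) : Prop :=
  (forall x, D x -> {for x, continuous f}) /\
  (forall i : chart_index M,
     smooth_on (D `&` f @^-1` chart_dom i) (chart_map i \o f)).

Definition differential {V : normedModType R} (f : V -> M) (x w : V) :
    tangent_family :=
  fun i => if `[< chart_dom i (f x) >] then diff_at (chart_map i \o f) x w else 0.

Lemma differential_tangent {V : normedModType R} (D : set V) (f : V -> M)
    (x w : V) :
  open D -> smooth_map D f -> D x -> tangent_space (f x) (differential f x w).
Proof.
move=> oD [cf sf] Dx; split=> [i|i j] ix; rewrite /differential.
  by rewrite asboolF.
move=> jx; rewrite !asboolT //.
have dfi : differentiable (chart_map i \o f) x.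
  by have [+ _] := sf i 1%N; apply.
have dt : differentiable (transition i j) ((chart_map i \o f) x).
  have [+ _] := chart_compatible i j 1%N; apply.
  by exists (f x).
have E : \forall y \near x,
    (transition i j \o (chart_map i \o f)) y = (chart_map j \o f) y.
  have : \forall y \near x, chart_dom i (f y).
    by apply: (cf _ Dx); apply: open_nbhs_nbhs; split=> //; exact: chart_dom_open.
  by apply: filterS => y iy /=; rewrite /transition chart_repE //;
    exact: chart_inj.
have dc := differentiable_comp dfi dt.
by rewrite -(near_eq_diff_at w E dc) diff_at_comp.
Qed.

End Tangent.

Arguments tangent_space {R m M} p.

(* J is a smooth bundle endomorphism of TM: it maps each T_pM to itself and, in
   each chart, is given on components by a smooth field A of matrices. *)
Record almostComplexManifold (R : realType) := AlmostComplexManifold {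
  complex_dim : nat ;
  acm_manifold :> smoothManifold R (2 * complex_dim) ;
  acJ : acm_manifold -> tangent_family acm_manifold ->
        tangent_family acm_manifold ;
  acJ_tangent : forall (p : acm_manifold) v,
    tangent_space p v -> tangent_space p (acJ p v) ;
  acJ_smooth : forall i : chart_index acm_manifold,
    exists A : acm_manifold -> 'M[R]_(2 * complex_dim),
      smooth_on (chart_map i @` chart_dom i)
        (chart_rep (chart_dom i) (chart_map i) A) /\
      (forall p v, chart_dom i p -> tangent_space p v ->
         acJ p v i = A p *m v i) ;
  acJ_square : forall (p : acm_manifold) v,
    tangent_space p v -> acJ p (acJ p v) = - v }.

Arguments acJ {R M} p v : rename.

Section OpenSubmanifold.
Context {R : realType} {m : nat} (M : smoothManifold R m).
Variables (U : set M) (oU : open U).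

Let udom (i : chart_index M) : set U := set_val @^-1` chart_dom i.
Let umap (i : chart_index M) : U -> 'cV[R]_m := chart_map i \o set_val.

Let val_cont : continuous (set_val : U -> M).
Proof. exact: initial_continuous. Qed.

Let val_inj' (x y : U) : set_val x = set_val y -> x = y.
Proof. by rewrite set_valE; exact: val_inj. Qed.

Let uhausdorff : hausdorff_space U.
Proof.
move=> x y cl; apply: val_inj'; apply: (@manifold_hausdorff _ _ M) => A B nA nB.
have [z [Az Bz]] := cl _ _ (val_cont nA) (val_cont nB).
by exists (set_val z).
Qed.

Let usecond_countable : @second_countable U.
Proof.
have [B cB [oB bB]] := @manifold_second_countable _ _ M.
exists [set set_val @^-1` b | b in B].
  exact: sub_countable (card_image_le _ _) cB.
split=> [_ [b Bb <-]|x A].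
  by move/continuousP: val_cont; apply; exact: oB.
move=> [_ [[C oC <-] Cx sCA]].
have [b [Bb bx] sbC] := bB _ C (open_nbhs_nbhs (conj oC Cx)).
exists (set_val @^-1` b); first by split=> //; exists b.
by move=> y by_; apply: sCA; exact: sbC.
Qed.

Let ucover p : exists i, udom i p.
Proof. exact: chart_cover. Qed.

Let uopen i : open (udom i).
Proof. by move/continuousP: val_cont; apply; exact: chart_dom_open. Qed.

Let ucontinuous i p : udom i p -> {for p, continuous (umap i)}.
Proof.
by move=> ip; apply: continuous_comp; [exact: val_cont|exact: chart_continuous].
Qed.

Let uinj i p q : udom i p -> udom i q -> umap i p = umap i q -> p = q.
Proof. by move=> ip iq e; apply: val_inj'; exact: chart_inj e. Qed.

Let uchart_open i (A : set U) : open A -> A `<=` udom i -> open (umap i @` A).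
Proof.
move=> [B oB <-] sA.
have -> : umap i @` (set_val @^-1` B) = chart_map i @` (B `&` U).
  rewrite eqEsubset; split=> _ [x Bx <-].
    by exists (set_val x) => //; split=> //; exact: set_valP.
  by case: Bx => Bx Ux; exists (SigSub (mem_set Ux)).
apply: chart_open; first exact: openI.
by move=> x [Bx Ux]; exact: (sA (SigSub (mem_set Ux)) Bx).
Qed.

Lemma sub_chart_rep (W : zmodType) (g : M -> W) i y : (umap i @` udom i) y ->
  chart_rep (udom i) (umap i) (g \o set_val) y =
  chart_rep (chart_dom i) (chart_map i) g y.
Proof.
move=> [x ix <-]; rewrite chart_repE //; last exact: uinj.
by rewrite /umap /= chart_repE //; exact: chart_inj.
Qed.

Lemma sub_smooth_on (W : normedModType R) (g : M -> W) i
    (A : set M) (B : set U) :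
  smooth_on (chart_map i @` A) (chart_rep (chart_dom i) (chart_map i) g) ->
  open B -> B `<=` udom i -> B `<=` set_val @^-1` A ->
  smooth_on (umap i @` B) (chart_rep (udom i) (umap i) (g \o set_val)).
Proof.
move=> sg oB Bi BA; apply: smooth_on_sub_eq sg; first exact: uchart_open.
  by move=> _ [x Bx <-]; exists (set_val x) => //; exact: BA.
move=> _ [x Bx <-]; rewrite sub_chart_rep //; exists x => //; exact: Bi.
Qed.

Let ucompatible i j :
  smooth_on (umap i @` (udom i `&` udom j))
    (chart_rep (udom i) (umap i) (umap j)).
Proof.
apply: sub_smooth_on (chart_compatible i j) _ _ _ => //.
exact: openI.
Qed.

Definition open_smooth : smoothManifold R m :=
  SmoothManifold uhausdorff usecond_countable ucover uopen ucontinuous uinj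
    uchart_open ucompatible.

Lemma sub_tangent_space (p : open_smooth) :
  tangent_space p = tangent_space (set_val p : M).
Proof.
have E (i j : chart_index M) v :
    chart_dom i (set_val p) -> chart_dom j (set_val p) ->
    diff_at (@transition _ _ open_smooth i j) (@chart_map _ _ open_smooth i p) v =
    diff_at (@transition _ _ M i j) (@chart_map _ _ M i (set_val p)) v.
  move=> ip jp.
  have dM : differentiable (@transition _ _ M i j) (umap i p).
    have [+ _] := @chart_compatible _ _ M i j 1%N; apply.
    by exists (set_val p).
  apply/esym; apply: near_eq_diff_at dM.
  have : nbhs (umap i p) (umap i @` udom i).
    by apply: open_nbhs_nbhs; split; [exact: uchart_open|exists p].
  by apply: filterS => y iy; apply/esym; exact: sub_chart_rep.
apply/seteqP; split=> v [v0 vt]; split=> [i|i j ip jp]; try exact: v0.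
  have e := E i j (v i) ip jp.
  by rewrite -e; exact: vt.
have e := E i j (v i) ip jp.
by rewrite e; exact: vt.
Qed.

End OpenSubmanifold.

(* The almost complex manifold (U, J|_U); its charts are the restrictions to U
   of those of M, so that T_pU = T_pM as families. *)
Section OpenAlmostComplex.
Context {R : realType} (M : almostComplexManifold R).
Variables (U : set M) (oU : open U).

Let N := open_smooth oU.
Let uJ (p : N) (v : tangent_family N) : tangent_family N :=
  acJ (set_val p : M) v.

Let uJ_tangent (p : N) v : tangent_space p v -> tangent_space p (uJ p v).
Proof. by rewrite sub_tangent_space; exact: acJ_tangent. Qed.

Let uJ_smooth (i : chart_index N) :
  exists A : N -> 'M[R]_(2 * complex_dim M),
      smooth_on (chart_map i @` chart_dom i)
        (chart_rep (chart_dom i) (chart_map i) A) /\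
      (forall p v, chart_dom i p -> tangent_space p v ->
         uJ p v i = A p *m v i).
Proof.
have [A [sA JA]] := acJ_smooth (i : chart_index M).
exists (A \o set_val); split.
  by apply: (sub_smooth_on oU sA) => //; exact: (@chart_dom_open _ _ N i).
by move=> p v ip; rewrite sub_tangent_space; exact: JA.
Qed.

Let uJ_square (p : N) v : tangent_space p v -> uJ p (uJ p v) = - v.
Proof. by rewrite sub_tangent_space; exact: acJ_square. Qed.

Definition open_submanifold : almostComplexManifold R :=
  AlmostComplexManifold uJ_tangent uJ_smooth uJ_square.

End OpenAlmostComplex.

Section Kobayashi.
Context {R : realType} (M : almostComplexManifold R).

(* C is identified with R * R by zeta = x + iy. *)
Definition unit_disc : set (R * R) := [set z | z.1 ^+ 2 + z.2 ^+ 2 < 1].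

Definition J_st (w : R * R) : R * R := (- w.2, w.1).

(* Only the values of f on the disc matter. *)
Definition J_holomorphic (f : R * R -> M) : Prop :=
  smooth_map unit_disc f /\
  (forall z w, unit_disc z ->
     differential f z (J_st w) = acJ (f z) (differential f z w)).

(* Equality in T_pM is equality of families, so v only matters in
   tangent_space p. *)
Definition kobayashi_royden (p : M) (v : tangent_family M) : \bar R :=
  ereal_inf [set a%:E | a in [set a : R | 0 < a /\
    exists f : R * R -> M, [/\ J_holomorphic f, f (0, 0) = p &
      differential f (0, 0) (1, 0) = a^-1 *: v]]].

(* Smoothness on the closed interval [a, b], end points included, is the
   existence of a smooth extension to a larger open interval. *)
Definition smooth_on_segment (a b : R) (gamma : R -> M) : Prop :=
  exists e : R, exists g : R -> M, [/\ 0 < e,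
    smooth_map (`]a - e, b + e[ : set R) g &
    forall t, a <= t <= b -> gamma t = g t].

Definition piecewise_smooth (gamma : R -> M) : Prop :=
  {within `[0, 1], continuous gamma} /\
  exists (n : nat) (t : nat -> R), [/\ t 0%N = 0, t n = 1 &
    forall i, (i < n)%N ->
      t i < t i.+1 /\ smooth_on_segment (t i) (t i.+1) gamma].

(* The derivative of gamma is only meaningful away from the finitely many break
   points, which do not affect the integral. *)
Definition kobayashi_length (gamma : R -> M) : \bar R :=
  (\int[lebesgue_measure]_(t in `[0%R, 1%R])
     kobayashi_royden (gamma t) (differential gamma t 1%R))%E.

Definition kobayashi_dist (p q : M) : \bar R :=
  ereal_inf [set kobayashi_length gamma | gamma in
    [set gamma : R -> M | [/\ piecewise_smooth gamma, gamma 0 = p &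
                              gamma 1 = q]]].

Definition kobayashi_ball (p : M) (r : R) : set M :=
  [set q | (kobayashi_dist p q < r%:E)%E].

Definition complete_hyperbolic : Prop :=
  forall (p : M) (r : R), 0 <= r -> compact (closure (kobayashi_ball p r)).

End Kobayashi.

(* Main.v *)
Require Import Defs.
From mathcomp Require Import all_boot all_order all_algebra.
From mathcomp Require Import all_classical all_reals all_analysis.
From mathcomp Require Import measurable_realfun.
From mathcomp Require Import ring lra.

(* In a chart, take for U a small Euclidean ball {|w - z0| < e} and put
   u = e^2 - |f - z0|^2 along a J-holomorphic disc f. The Cauchy-Riemann
   equations f_y = A(f) f_x, f_x = - A(f) f_y give
   Lap f = (A(f))_y f_x - (A(f))_x f_y, which is quadratic in the gradient of f;
   hence, with s = |grad f|^2 and D = |Hess f|,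
     - 3s <= Lap u <= - s,  Lap s >= D^2 - K s^2,
     |grad s| <= K sqrt(s) D,  |grad (Lap u)| <= K (sqrt(s) D + s sqrt(s)).
   The maximum principle applied to cutoff * s / u bounds s by a multiple of u;
   applied to cutoff * (|grad u|^2 + s u) / u^2 as in the Cheng-Yau gradient
   estimate, it then gives |grad u| <= C u at the centre of the disc. So
   K(q, v) >= |d(log u)(v)| / C: log u is Lipschitz for the Kobayashi
   pseudodistance, and Kobayashi balls stay in the compact sets {u >= c > 0}. *)

Set Implicit Arguments.
Unset Strict Implicit.
Unset Printing Implicit Defensive.

Import Order.TTheory GRing.Theory Num.Theory.
Import numFieldNormedType.Exports.

Local Open Scope classical_set_scope.
Local Open Scope ring_scope.

(** * Smooth functions *)

(** In a chart nothing is left of [J] but the two Cauchy-Riemann equations and bounds on the first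
    and second derivatives of [A] near [z0], so all constants depend on these bounds and the
    dimension, not on the disc. A positive superharmonic [u] need not satisfy [|grad u| <= C u]:
    [Lap u / u] has to be bounded first, which is why [s <= C u] comes before the gradient estimate.
    The Laplacian of [|grad u|^2] contains [2 grad u . grad (Lap u)], which involves the
    uncontrolled [D]; the summand [s u] is there because [u Lap s] contributes [u D^2], enough to
    absorb it. With [Q = |grad u|^2 / u^2], the Laplacian inequality at the maximum gives
    [2 |Hess u|^2 / u^2] at most about [2 Q^2]. The vanishing gradient makes the Hessian about [Q u]
    along [grad u], and in the plane its almost vanishing trace makes it about [- Q u] across, so
    the same quantity is at least about [4 Q^2]. Hence [Q] cannot be large. The radius [e] is small
    for two reasons: to absorb [(f - z0) . Lap f] in [Lap u], and to have [K u <= 1/2], which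
    absorbs the term [K s^2] of [Lap s]. *)

Section SmoothClosure.
Context {R : realType} {V : normedModType R}.
Implicit Types (D : set V).

Section Valued.
Context {W : normedModType R}.
Implicit Types (f g : V -> W).

Lemma CkW k D f : Ck k.+1 D f -> Ck k D f.
Proof.
elim: k f => [|k IH] f /=.
  by move=> [df _] x Dx; apply: differentiable_continuous; exact: df.
by move=> [df Df]; split=> // v; exact: IH (Df v).
Qed.

Lemma Ck_near_eq k D f g : open D -> (forall x, D x -> f x = g x) ->
  Ck k D f -> Ck k D g.
Proof. by move=> oD; exact: Ck_sub_eq. Qed.

Lemma Ck_cst k D (w : W) : Ck k D (cst w).
Proof.
elim: k w => [|k IH] w /=; first by move=> x _; exact: cst_continuous.
split=> [x _|v]; first exact: differentiable_cst.
by rewrite (_ : (fun x => _) = cst 0); [exact: IH|apply/funext => x; rewrite derive_cst].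
Qed.

Lemma CkD k D f g : open D -> Ck k D f -> Ck k D g -> Ck k D (f + g).
Proof.
move=> oD; elim: k f g => [|k IH] f g /=.
  by move=> cf cg x Dx; apply: continuousD; [exact: cf|exact: cg].
move=> [df Df] [dg Dg]; split=> [x Dx|v].
  by apply: differentiableD; [exact: df|exact: dg].
apply: Ck_near_eq (IH _ _ (Df v) (Dg v)) => // x Dx.
by rewrite fctE deriveD//; apply: diff_derivable; [exact: df|exact: dg].
Qed.

Lemma smooth_cst D (w : W) : smooth_on D (cst w).
Proof. by move=> k; exact: Ck_cst. Qed.

Lemma smoothD D f g : open D ->
  smooth_on D f -> smooth_on D g -> smooth_on D (f + g).
Proof. by move=> oD sf sg k; exact: CkD. Qed.

Lemma smooth_sum D n (f : 'I_n -> V -> W) : open D ->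
  (forall i, smooth_on D (f i)) -> smooth_on D (\sum_i f i).
Proof.
move=> oD sf; elim/big_ind : _ => [|h1 h2|i _]; last exact: sf.
  exact: smooth_cst.
exact: smoothD.
Qed.

Lemma smooth_derive D f v : smooth_on D f -> smooth_on D ('D_v f).
Proof. by move=> sf k; have [_] := sf k.+1; apply. Qed.

Lemma smooth_differentiable D f x : smooth_on D f -> D x -> differentiable f x.
Proof. by move=> sf Dx; have [+ _] := sf 1%N; apply. Qed.

Lemma smooth_derivable D f x v : smooth_on D f -> D x -> derivable f x v.
Proof. by move=> sf Dx; apply: diff_derivable; exact: smooth_differentiable Dx. Qed.

Lemma smooth_continuous D f x : smooth_on D f -> D x -> {for x, continuous f}.
Proof. by move=> sf; exact: (sf 0%N). Qed.

Lemma eq_on_derive D f g x v : open D -> D x -> (forall y, D y -> f y = g y) ->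
  'D_v f x = 'D_v g x.
Proof.
move=> oD Dx fg; apply: near_eq_derive; apply: filterS fg _.
exact: open_nbhs_nbhs.
Qed.

End Valued.

Implicit Types (f g : V -> R).

Lemma CkM k D f g : open D -> Ck k D f -> Ck k D g -> Ck k D (f * g).
Proof.
move=> oD; elim: k f g => [|k IH] f g.
  by move=> cf cg x Dx; apply: continuousM; [exact: cf|exact: cg].
move=> sf sg; have [df Df] := sf; have [dg Dg] := sg; split=> [x Dx|v].
  by apply: differentiableM; [exact: df|exact: dg].
have := CkD oD (IH _ _ (CkW sf) (Dg v)) (IH _ _ (CkW sg) (Df v)).
apply: Ck_near_eq => // x Dx.
by rewrite !fctE deriveM//; apply: diff_derivable; [exact: df|exact: dg].
Qed.

Lemma smoothM D f g : open D ->
  smooth_on D f -> smooth_on D g -> smooth_on D (f * g).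
Proof. by move=> oD sf sg k; exact: CkM. Qed.

Lemma smoothN D f : open D -> smooth_on D f -> smooth_on D (- f).
Proof.
move=> oD sf; rewrite -mulN1r; apply: smoothM => //.
exact: (@smooth_cst R D (-1)).
Qed.

Lemma smoothB D f g : open D ->
  smooth_on D f -> smooth_on D g -> smooth_on D (f - g).
Proof. by move=> oD sf sg; apply: smoothD => //; exact: smoothN. Qed.

End SmoothClosure.

Section Entries.
Context {R : realType} {V : normedModType R} {m n : nat}.

Lemma smooth_entry (D : set V) (f : V -> 'M[R]_(m, n)) i j :
  open D -> smooth_on D f -> smooth_on D (fun x => f x i j).
Proof.
move=> oD sf k; elim: k f sf => [|k IH] f sf.
  move=> x Dx; apply: differentiable_continuous.
  apply: (@differentiable_comp _ _ _ _ f (fun M : 'M[R]_(m, n) => M i j)).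
    exact: smooth_differentiable Dx.
  exact: differentiable_coord.
split=> [x Dx|v].
  apply: (@differentiable_comp _ _ _ _ f (fun M : 'M[R]_(m, n) => M i j)).
    exact: smooth_differentiable Dx.
  exact: differentiable_coord.
apply: Ck_near_eq (IH _ (smooth_derive v sf)) => // x Dx.
by rewrite derive_mx ?mxE//; exact: smooth_derivable Dx.
Qed.

End Entries.

Section Composition.
Context {R : realType} {V : normedModType R} {m : nat}.
Implicit Types (D : set V) (f : V -> 'cV[R]_m).

Definition basis_vec (i : 'I_m) : 'cV[R]_m := delta_mx i 0.

Definition coordf f (i : 'I_m) : V -> R := fun x => f x i 0.

Lemma derive_coordf f i x v : derivable f x v ->
  'D_v (coordf f i) x = ('D_v f x) i 0.
Proof. by move=> df; rewrite derive_mx // mxE. Qed.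

Lemma smooth_coordf D f i : open D -> smooth_on D f -> smooth_on D (coordf f i).
Proof. exact: smooth_entry. Qed.

Lemma cV_basis (w : 'cV[R]_m) : w = \sum_i w i 0 *: basis_vec i.
Proof.
apply/matrixP => i j; rewrite summxE (bigD1 i)//= !mxE ord1 !eqxx mulr1.
rewrite big1 ?addr0// => l li; rewrite !mxE.
by rewrite eq_sym (negPf li) mulr0.
Qed.

Lemma linear_cV (L : {linear 'cV[R]_m -> R}) (w : 'cV[R]_m) :
  L w = \sum_i L (basis_vec i) * w i 0.
Proof.
rewrite [in LHS](cV_basis w) linear_sum; apply: eq_bigr => i _.
by rewrite linearZ/= mulrC.
Qed.

Lemma derive_comp_coord f (a : 'cV[R]_m -> R) x v :
  differentiable f x -> differentiable a (f x) ->
  'D_v (a \o f) x = \sum_i 'D_(basis_vec i) a (f x) * 'D_v (coordf f i) x.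
Proof.
move=> df da; have dfv : derivable f x v by exact: diff_derivable.
have -> : 'D_v (a \o f) x = diff_at a (f x) ('D_v f x).
  rewrite (deriveE v df) -/(diff_at f x v) -diff_at_comp//.
  by rewrite /diff_at -deriveE//; exact: differentiable_comp.
rewrite /diff_at linear_cV; apply: eq_bigr => i _.
by rewrite (deriveE _ da) derive_coordf.
Qed.

(** Induction on the order, for all [a] at once: by the chain rule a derivative of [a \o f] is a sum
    of products of ['D_(basis_vec i) a \o f], to which the induction hypothesis applies, with
    derivatives of the coordinates of [f]. *)
Lemma smooth_comp_coord D f (B : set 'cV[R]_m) (a : 'cV[R]_m -> R) : open D ->
  (forall x, D x -> B (f x)) -> smooth_on D f -> smooth_on B a ->
  smooth_on D (a \o f).
Proof.
move=> oD fB sf sa k; elim: k a sa => [|k IH] a sa.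
  move=> x Dx; apply: differentiable_continuous; apply: differentiable_comp.
    exact: smooth_differentiable Dx.
  by apply: smooth_differentiable sa _; exact: fB.
split=> [x Dx|v].
  apply: differentiable_comp; first exact: smooth_differentiable Dx.
  by apply: smooth_differentiable sa _; exact: fB.
have : Ck k D (\sum_i (('D_(basis_vec i) a \o f) * 'D_v (coordf f i))).
  elim/big_ind : _ => [|h1 h2|i _]; first exact: (@Ck_cst _ _ R k D 0).
    exact: CkD.
  apply: CkM => //; first by apply: IH; exact: smooth_derive.
  by apply: smooth_derive; exact: smooth_coordf.
apply: Ck_near_eq => // x Dx.
rewrite fct_sumE derive_comp_coord//; first exact: smooth_differentiable Dx.
by apply: smooth_differentiable sa _; exact: fB.
Qed.

End Composition.

(** * Symmetry of second derivatives and the second derivative test *)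

Section SecondOrder.
Context {R : realType} {V : normedModType R}.
Implicit Types (D : set V) (f g : V -> R) (x v w : V).

Lemma is_derive_line {W : normedModType R} (f : V -> W) x v (t : R) :
  derivable f (x + t *: v) v ->
  is_derive t 1 (fun s : R => f (x + s *: v)) ('D_v f (x + t *: v)).
Proof.
move=> df.
have E : (fun h : R => h^-1 *: (((fun s : R => f (x + s *: v)) \o shift t)
    (h *: (1 : R)) - f (x + t *: v))) =
  (fun h : R => h^-1 *: ((f \o shift (x + t *: v)) (h *: v) - f (x + t *: v))).
  apply/funext => h /=.
  by rewrite [h *: 1]mulr1 scalerDl addrCA.
by apply: DeriveDef; rewrite ?/derivable ?/derive E.
Qed.

Lemma is_derive_cvg (g : R -> R) (l : R) : is_derive (0 : R) 1 g l ->
  h^-1 * (g h - g 0) @[h --> (0 : R)^'] --> l.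
Proof.
move=> [cd <-]; move: cd; rewrite /derivable /derive /=.
rewrite (_ : (fun h : R => _) = (fun h => h^-1 * (g h - g 0))) //.
by apply/funext => h; rewrite addr0 [h%:A]mulr1.
Qed.

Local Opaque derive.

Lemma near_plane D x v w : open D -> D x ->
  exists2 e : R, 0 < e &
    forall s t : R, `|s| < e -> `|t| < e -> D (x + s *: v + t *: w).
Proof.
move=> oD Dx.
pose h (p : R * R) := x + p.1 *: v + p.2 *: w.
have ch : h p @[p --> ((0, 0) : R * R)] --> h (0, 0).
  apply: cvgD; first apply: cvgD; first exact: cvg_cst.
    by apply: cvgZr_tmp; exact: cvg_fst.
  by apply: cvgZr_tmp; exact: cvg_snd.
have nD : nbhs (h (0, 0)) D.
  by rewrite /h /= !scale0r !addr0; exact: open_nbhs_nbhs.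
have /nbhs_ballP[e /= e0 eD] := ch _ nD.
by exists e => // s t se te; apply: (eD (s, t)); split;
  rewrite /ball/= sub0r normrN.
Qed.

(** The mean value theorem is used twice: along [v] for the difference of [f] on two parallel sides
    of the parallelogram, then along [w] for ['D_v f]. The left-hand side is symmetric in [v] and
    [w], the right-hand side is not; [schwarz] exploits this. *)
Lemma second_difference D f x v w (e : R) : open D -> smooth_on D f -> 0 < e ->
  (forall s t : R, `|s| <= e -> `|t| <= e -> D (x + s *: v + t *: w)) ->
  exists s t : R, [/\ 0 <= s <= e, 0 <= t <= e &
    f (x + e *: v + e *: w) - f (x + e *: v) - f (x + e *: w) + f x =
    'D_w ('D_v f) (x + s *: v + t *: w) * e * e].
Proof.
move=> oD sf e0 De.
pose g (s : R) := f (x + e *: w + s *: v) - f (x + s *: v).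
pose dg (s : R) := 'D_v f (x + e *: w + s *: v) - 'D_v f (x + s *: v).
have E s : x + e *: w + s *: v = x + s *: v + e *: w by rewrite addrAC.
have ne : `|e| <= e by rewrite gtr0_norm.
have D1 s : `|s| <= e -> D (x + e *: w + s *: v) by move=> se; rewrite E; exact: De.
have D2 s : `|s| <= e -> D (x + s *: v).
  by move=> se; rewrite -[_ + _]addr0 -(scale0r w); apply: De => //; rewrite normr0 ltW.
have ab s : s \in `[0, e] -> `|s| <= e.
  by rewrite in_itv/= => /andP[s0 se]; rewrite ger0_norm.
have ooW (s : R) : s \in `]0, e[ -> s \in `[0, e].
  by rewrite !in_itv/= => /andP[/ltW -> /ltW ->].
have dgs s : s \in `[0, e] -> is_derive s 1 g (dg s).
  move=> /ab se; apply: is_deriveB; apply: is_derive_line.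
    by apply: smooth_derivable sf _; exact: D1.
  by apply: smooth_derivable sf _; exact: D2.
have H1 s : s \in `]0, e[ -> is_derive s 1 g (dg s) by move=> /ooW; exact: dgs.
have H2 : {within `[0, e], continuous g}.
  apply: derivable_within_continuous => s se.
  by have [] := dgs _ se.
have [s se] := MVT_segment (ltW e0) H1 H2; rewrite /g scale0r !addr0 subr0 => Eg.
pose k (t : R) := 'D_v f (x + s *: v + t *: w).
pose dk (t : R) := 'D_w ('D_v f) (x + s *: v + t *: w).
have dks t : t \in `[0, e] -> is_derive t 1 k (dk t).
  move=> /ab te; apply: is_derive_line.
  apply: smooth_derivable (smooth_derive v sf) _; apply: De => //; exact: ab.
have K1 t : t \in `]0, e[ -> is_derive t 1 k (dk t) by move=> /ooW; exact: dks.
have K2 : {within `[0, e], continuous k}.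
  apply: derivable_within_continuous => t te.
  by have [] := dks _ te.
have [t te] := MVT_segment (ltW e0) K1 K2; rewrite /k scale0r !addr0 subr0 => Ek.
exists s, t; split; [by move: se; rewrite in_itv|by move: te; rewrite in_itv|].
rewrite -/(dk t) -Ek -E.
by move: Eg; rewrite /dg !E => <-; ring.
Qed.

(** The second difference over one small parallelogram, read in both orders, equates the two mixed
    derivatives at two points near [x]; continuity of both carries the equality to [x] up to any
    [e]. *)
Lemma schwarz D f x v w : open D -> smooth_on D f -> D x ->
  'D_v ('D_w f) x = 'D_w ('D_v f) x.
Proof.
move=> oD sf Dx.
have tri (a b p q e : R) : `|a - q| < e / 2 -> `|b - p| < e / 2 -> p = q ->
    `|a - b| <= e.
  by move=> aq bp pq; rewrite (le_trans (ler_distD q _ _))// -{2}pq (distrC p); lra.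
have c1 := smooth_continuous (smooth_derive v (smooth_derive w sf)) Dx.
have c2 := smooth_continuous (smooth_derive w (smooth_derive v sf)) Dx.
apply/eqP; rewrite -subr_eq0 -normr_le0; apply/ler_addgt0Pl => e e0.
rewrite addr0.
have e20 : 0 < e / 2 by rewrite divr_gt0.
have n1 : nbhs x (D `&` ([set y | `|'D_v ('D_w f) x - 'D_v ('D_w f) y| < e / 2] `&`
   [set y | `|'D_w ('D_v f) x - 'D_w ('D_v f) y| < e / 2])).
  apply: filterI; first exact: open_nbhs_nbhs.
  by apply: filterI; [move/cvgrPdist_lt : c1|move/cvgrPdist_lt : c2]; apply.
move: n1; rewrite nbhsE => -[B [oB Bx] BD].
have [d d0 dB] := near_plane v w oB Bx.
have d2 : 0 < d / 2 by rewrite divr_gt0.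
have hd (s : R) : `|s| <= d / 2 -> `|s| < d by move=> /le_lt_trans; apply; lra.
have [|s [t [sd td E1]]] := @second_difference D f x v w (d / 2) oD sf d2.
  by move=> s t sd td; apply: (BD _ _).1; apply: dB; exact: hd.
have [|s' [t' [sd' td' E2]]] := @second_difference D f x w v (d / 2) oD sf d2.
  move=> s' t' sd' td'; rewrite addrAC.
  by apply: (BD _ _).1; apply: dB; exact: hd.
have hn (r : R) : 0 <= r <= d / 2 -> `|r| < d.
  by move=> /andP[r0 rd]; apply: hd; rewrite ger0_norm.
have [_ [_ B1]] := BD _ (dB _ _ (hn _ sd) (hn _ td)).
have [_ [B2 _]] := BD _ (dB _ _ (hn _ td') (hn _ sd')).
have E : 'D_w ('D_v f) (x + s *: v + t *: w) = 'D_v ('D_w f) (x + t' *: v + s' *: w).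
  have key (a b c k p q r : R) : r != 0 -> a - b - c + k = p * r * r ->
      a - c - b + k = q * r * r -> p = q.
    by move=> r0; rewrite (addrAC a) => -> /(mulIf r0) /(mulIf r0).
  rewrite (addrAC x (t' *: v)); move: E1 E2; rewrite (addrAC x (_ *: w) (_ *: v)).
  exact (key _ _ _ _ _ _ _ (lt0r_neq0 d2)).
exact (tri _ _ _ _ _ B2 B1 E).
Qed.

Lemma derive_at_min D f x v : open D -> smooth_on D f -> D x ->
  (forall y, D y -> f x <= f y) -> 'D_v f x = 0 /\ 0 <= 'D_v ('D_v f) x.
Proof.
move=> oD sf Dx fmin.
have [e e0 De] := near_plane v 0 oD Dx.
have {}De (t : R) : `|t| < e -> D (x + t *: v).
  move=> te; have := De t 0 te; rewrite normr0 => /(_ e0).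
  by rewrite scaler0 addr0.
pose g (t : R) := f (x + t *: v).
have dg (t : R) : `|t| < e -> is_derive t 1 g ('D_v f (x + t *: v)).
  by move=> te; apply: is_derive_line; exact: smooth_derivable sf (De _ te).
have Dv0 : 'D_v f x = 0.
  have [_] : is_derive (0 : R) 1 g 0.
    apply: (@derive1_at_min _ g (- e) e 0).
    - lra.
    - by move=> t; rewrite in_itv/= -ltr_norml => /dg [].
    - by rewrite in_itv/=; apply/andP; split; lra.
    - by move=> t; rewrite in_itv/= -ltr_norml => /De/fmin; rewrite /g scale0r addr0.
  by have [_ ->] := dg 0 ltac:(by rewrite normr0); rewrite scale0r addr0.
(* If the second derivative were negative, ['D_v f] would be negative just beyond [x] on the line,
   and the mean value theorem would give a value of [f] below the minimum. *)
split => //; rewrite leNgt; apply/negP => Dvv.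
have dd : is_derive (0 : R) 1 (fun s : R => 'D_v f (x + s *: v)) ('D_v ('D_v f) x).
  rewrite -[in X in is_derive _ _ _ X](addr0 x) -(scale0r v).
  apply: is_derive_line; rewrite scale0r addr0.
  exact: smooth_derivable (smooth_derive v sf) Dx.
have := is_derive_cvg dd.
move=> /cvgr_lt /(_ _ Dvv); rewrite /dnbhs /within /= => -/nbhs_ballP[d /= d0 dh].
pose r := Num.min d e / 2.
have r0 : 0 < r by rewrite divr_gt0// lt_min d0 e0.
have rd : r < d by rewrite /r; case: (leP d e) => h; lra.
have re : r < e by rewrite /r; case: (leP d e) => h; lra.
have M1 (t : R) : t \in `]0, r[ -> is_derive t 1 g ('D_v f (x + t *: v)).
  by rewrite in_itv/= => /andP[t0 tr]; apply: dg; rewrite gtr0_norm//; lra.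
have M2 : {within `[0, r], continuous g}.
  apply: derivable_within_continuous => t; rewrite in_itv/= => /andP[t0 tr].
  have te : `|t| < e by rewrite ger0_norm//; lra.
  by have [] := dg _ te.
have [c] := MVT r0 M1 M2.
rewrite in_itv/= => /andP[c0 cr] Eg.
have : c^-1 * ('D_v f (x + c *: v) - 'D_v f (x + 0 *: v)) < 0.
  apply: dh; last by rewrite gt_eqF.
  by rewrite /ball/= sub0r normrN gtr0_norm//; lra.
rewrite scale0r addr0 Dv0 subr0 pmulr_rlt0 ?invr_gt0// => Dc.
have : g 0 <= g r.
  by rewrite /g scale0r addr0; apply: fmin; apply: De; rewrite gtr0_norm.
by rewrite -subr_ge0 Eg subr0 pmulr_lge0// leNgt Dc.
Qed.

End SecondOrder.

(** * Calculus in the plane *)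

Section Plane.
Context {R : realType}.
Implicit Types (D : set (R * R)) (f g : R * R -> R) (z : R * R).

Definition plane_dir (b : bool) : R * R := if b then (0, 1) else (1, 0).

(* Locked, since unification otherwise unfolds derivatives down to limits. *)
Definition pd (b : bool) f : R * R -> R := locked ('D_(plane_dir b) f).

Lemma pdE b f : pd b f = 'D_(plane_dir b) f.
Proof. by rewrite /pd -lock. Qed.

Definition lap f : R * R -> R := pd false (pd false f) + pd true (pd true f).

Lemma lapE f z : lap f z = pd false (pd false f) z + pd true (pd true f) z.
Proof. by []. Qed.

Section Rules.
Variables (D : set (R * R)) (oD : open D).

Lemma smooth_pd b f : smooth_on D f -> smooth_on D (pd b f).
Proof. rewrite pdE; exact: smooth_derive. Qed.

Lemma smooth_lap f : smooth_on D f -> smooth_on D (lap f).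
Proof. by move=> sf; rewrite /lap; apply: smoothD => //; apply: smooth_pd; exact: smooth_pd. Qed.

Lemma eq_on_pd b f g z : D z -> (forall y, D y -> f y = g y) ->
  pd b f z = pd b g z.
Proof. rewrite !pdE; exact: eq_on_derive. Qed.

Lemma pdD b f g z : smooth_on D f -> smooth_on D g -> D z ->
  pd b (f + g) z = pd b f z + pd b g z.
Proof.
by move=> sf sg Dz; rewrite !pdE; apply: deriveD; [exact: smooth_derivable sf Dz|
  exact: smooth_derivable sg Dz].
Qed.

Lemma pdB b f g z : smooth_on D f -> smooth_on D g -> D z ->
  pd b (f - g) z = pd b f z - pd b g z.
Proof.
by move=> sf sg Dz; rewrite !pdE; apply: deriveB; [exact: smooth_derivable sf Dz|
  exact: smooth_derivable sg Dz].
Qed.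

Lemma pdM b f g z : smooth_on D f -> smooth_on D g -> D z ->
  pd b (f * g) z = f z * pd b g z + g z * pd b f z.
Proof.
by move=> sf sg Dz; rewrite !pdE; apply: deriveM; [exact: smooth_derivable sf Dz|
  exact: smooth_derivable sg Dz].
Qed.

Lemma pd_cst b (c : R) z : pd b (cst c) z = 0.
Proof. rewrite pdE; exact: derive_cst. Qed.

Lemma pd_sum n b (h : 'I_n -> R * R -> R) z :
  (forall i, smooth_on D (h i)) -> D z ->
  pd b (\sum_i h i) z = \sum_i pd b (h i) z.
Proof.
move=> sh Dz; rewrite pdE derive_sum => [|i]; last exact: smooth_derivable (sh i) Dz.
by apply: eq_bigr => i _; rewrite pdE.
Qed.

Lemma lapD f g z : smooth_on D f -> smooth_on D g -> D z ->
  lap (f + g) z = lap f z + lap g z.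
Proof.
move=> sf sg Dz.
have E b : pd b (pd b (f + g)) z = pd b (pd b f) z + pd b (pd b g) z.
  rewrite -(pdD b (smooth_pd b sf) (smooth_pd b sg) Dz).
  by apply: eq_on_pd Dz _ => y Dy; exact: pdD.
rewrite !lapE.
rewrite (E false) (E true); exact: addrACA.
Qed.

Lemma lapM f g z : smooth_on D f -> smooth_on D g -> D z ->
  lap (f * g) z = f z * lap g z + g z * lap f z
    + 2 * (pd false f z * pd false g z + pd true f z * pd true g z).
Proof.
move=> sf sg Dz.
have alg1 (x a b y c d : R) : x * a + b * c + (y * d + c * b) =
  x * a + y * d + 2 * (c * b) by ring.
have alg2 (x y a b c d p q : R) : x * a + y * b + 2 * p + (x * c + y * d + 2 * q) =
  x * (a + c) + y * (b + d) + 2 * (p + q) by ring.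
have E b : pd b (pd b (f * g)) z =
    f z * pd b (pd b g) z + g z * pd b (pd b f) z + 2 * (pd b f z * pd b g z).
  have sfb := smooth_pd b sf; have sgb := smooth_pd b sg.
  have -> : pd b (pd b (f * g)) z = pd b (f * pd b g + g * pd b f) z.
    by apply: eq_on_pd Dz _ => y Dy; exact: pdM.
  rewrite (pdD b (smoothM oD sf sgb) (smoothM oD sg sfb) Dz).
  rewrite (pdM b sf sgb Dz) (pdM b sg sfb Dz); exact: alg1.
rewrite !lapE (E false) (E true); exact: alg2.
Qed.

Lemma lap_cst (c : R) z : D z -> lap (cst c) z = 0.
Proof.
move=> Dz; have E b : pd b (pd b (cst c)) z = 0.
  rewrite -(pd_cst b 0 z); apply: eq_on_pd => // y Dy; exact: pd_cst.
by rewrite lapE (E false) (E true) addr0.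
Qed.

Lemma lapB f g z : smooth_on D f -> smooth_on D g -> D z ->
  lap (f - g) z = lap f z - lap g z.
Proof.
move=> sf sg Dz; have := lapD (smoothB oD sf sg) sg Dz.
by rewrite (subrK g f) => ->; rewrite addrK.
Qed.

Lemma lapZ (c : R) f z : smooth_on D f -> D z ->
  lap (cst c * f) z = c * lap f z.
Proof.
move=> sf Dz; rewrite (lapM (@smooth_cst _ _ _ D c) sf Dz).
rewrite (lap_cst c Dz) !pd_cst !mul0r add0r mulr0 addr0.
by rewrite mulr0 addr0.
Qed.

Lemma pdZ b (c : R) f z : smooth_on D f -> D z ->
  pd b (cst c * f) z = c * pd b f z.
Proof.
move=> sf Dz; rewrite (pdM b (@smooth_cst _ _ _ D c) sf Dz).
by rewrite pd_cst mulr0 addr0.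
Qed.

Lemma lap_sum n (h : 'I_n -> R * R -> R) z :
  (forall i, smooth_on D (h i)) -> D z ->
  lap (\sum_i h i) z = \sum_i lap (h i) z.
Proof.
move=> sh Dz.
suff [_ ->] : smooth_on D (\sum_i h i) /\ lap (\sum_i h i) z = \sum_i lap (h i) z by [].
elim/big_ind2 : _ => [|f1 l1 f2 l2 [s1 E1] [s2 E2]|i _].
- by split; [exact: smooth_cst|exact: lap_cst].
- by split; [exact: smoothD|rewrite (lapD s1 s2 Dz) E1 E2].
- by split.
Qed.

Lemma pdC a b f z : smooth_on D f -> D z -> pd a (pd b f) z = pd b (pd a f) z.
Proof. by move=> sf Dz; rewrite !pdE; exact: schwarz sf Dz. Qed.

Lemma lap_pd b f z : smooth_on D f -> D z -> lap (pd b f) z = pd b (lap f) z.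
Proof.
move=> sf Dz.
have E a : pd a (pd a (pd b f)) z = pd b (pd a (pd a f)) z.
  rewrite -(pdC a b (smooth_pd a sf) Dz).
  by apply: eq_on_pd Dz _ => y Dy; exact: pdC.
rewrite lapE (E false) (E true).
by rewrite -(pdD b (smooth_pd _ (smooth_pd _ sf)) (smooth_pd _ (smooth_pd _ sf)) Dz).
Qed.

Lemma pd_lap_at_min f z : smooth_on D f -> D z ->
  (forall y, D y -> f z <= f y) -> (forall b, pd b f z = 0) /\ 0 <= lap f z.
Proof.
move=> sf Dz fz; have H b : pd b f z = 0 /\ 0 <= pd b (pd b f) z.
  by rewrite !pdE; exact: derive_at_min oD sf Dz fz.
split=> [b|]; first by have [] := H b.
rewrite lapE.
by apply: addr_ge0; [exact: (H false).2|exact: (H true).2].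
Qed.

End Rules.

Definition sqn : R * R -> R := fun z => z.1 * z.1 + z.2 * z.2.

Lemma unit_discE : @unit_disc R = [set z | sqn z < 1].
Proof. by []. Qed.

Lemma continuous_sqn : continuous sqn.
Proof.
move=> z; apply: cvgD; apply: cvgM; (exact: cvg_fst || exact: cvg_snd).
Qed.

Lemma open_sqn_lt (c : R) : open [set z | sqn z < c].
Proof.
rewrite (_ : [set z | _] = sqn @^-1` [set x | x < c])//.
by apply: open_comp => [z _|]; [exact: continuous_sqn|exact: open_lt].
Qed.

Lemma open_unit_disc : open (@unit_disc R).
Proof. exact: open_sqn_lt. Qed.

Lemma compact_sqn_le (c : R) : compact [set z | sqn z <= c].
Proof.
have cl : closed [set z | sqn z <= c].
  rewrite (_ : [set z | _] = sqn @^-1` [set x | x <= c])//.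
  by apply: preimage_closed => [z _|]; [exact: continuous_sqn|exact: closed_le].
have cK : compact (`[- (c + 1), c + 1] `*` `[- (c + 1), c + 1] : set (R * R)).
  by apply: compact_setX; exact: segment_compact.
apply: (subclosed_compact cl cK).
by move=> [x y]; rewrite /sqn /= => h; split; rewrite /= in_itv/=; apply/andP; split; nra.
Qed.

Lemma is_derive_affine (h : {linear (R * R)%type -> R}) z v :
  is_derive z v h (h v).
Proof.
have E : (fun k : R => k^-1 *: ((h \o shift z) (k *: v) - h z)) @ 0^' --> h v.
  have : (fun=> h v) @ (0 : R)^' --> h v by exact: cvg_cst.
  apply: cvg_trans; apply: near_eq_cvg; near=> k.
  rewrite /= (linearD h) addrK (linearZ_LR h) /= scalerA mulVf ?scale1r//.
  near: k; exact: nbhs_dnbhs_neq.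
apply: DeriveDef; first by apply/cvg_ex; exists (h v).
exact: cvg_lim E.
Unshelve. all: by end_near. Qed.

Lemma smooth_linear (h : {linear (R * R)%type -> R}) D :
  continuous h -> smooth_on D h.
Proof.
move=> ch [|k]; first by move=> z _; exact: ch.
split=> [z _|v]; first exact: linear_differentiable.
rewrite (_ : (fun x => _) = cst (h v)); first exact: Ck_cst.
by apply/funext => z; have [_ ->] := is_derive_affine h z v.
Qed.

Lemma pd_linear (h : {linear (R * R)%type -> R}) b z : pd b h z = h (plane_dir b).
Proof. by rewrite pdE; have [_ ->] := is_derive_affine h z (plane_dir b). Qed.

Lemma smooth_fst D : smooth_on D (fst : R * R -> R).
Proof. by apply: (@smooth_linear fst) => z; exact: cvg_fst. Qed.

Lemma smooth_snd D : smooth_on D (snd : R * R -> R).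
Proof. by apply: (@smooth_linear snd) => z; exact: cvg_snd. Qed.

Lemma pd_fst b z : pd b (fst : R * R -> R) z = (~~ b)%:R.
Proof. by rewrite (pd_linear fst); case: b. Qed.

Lemma pd_snd b z : pd b (snd : R * R -> R) z = b%:R.
Proof. by rewrite (pd_linear snd); case: b. Qed.

End Plane.

(** * The maximum principle on the disc *)

Section MaximumPrinciple.
Context {R : realType}.
Implicit Types (f g A w : R * R -> R) (z : R * R).

Local Notation Disc := (@unit_disc R).

Definition cutoff (c : R) : R * R -> R := cst c - (fst * fst + snd * snd).

(** Squared so that it vanishes to second order on the circle: its gradient keeps a factor
    [cutoff c], and the cross terms of the maximum principle can be absorbed into terms carrying
    [cutoff2 c]. *)
Definition cutoff2 (c : R) : R * R -> R := cutoff c * cutoff c.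

Definition coord (b : bool) z : R := if b then z.2 else z.1.

Lemma cutoffE c z : cutoff c z = c - sqn z.
Proof. by []. Qed.

Lemma smooth_cutoff c (D : set (R * R)) : open D -> smooth_on D (cutoff c).
Proof.
move=> oD; rewrite /cutoff; apply: smoothB => //; first exact: smooth_cst.
apply: smoothD => //; apply: smoothM => //.
- exact: smooth_fst.
- exact: smooth_fst.
- exact: smooth_snd.
- exact: smooth_snd.
Qed.

Lemma smooth_cutoff2 c (D : set (R * R)) : open D -> smooth_on D (cutoff2 c).
Proof. by move=> oD; apply: smoothM => //; exact: smooth_cutoff. Qed.

Lemma pd_cutoff c b z : pd b (cutoff c) z = - 2 * coord b z.
Proof.
have T : [set: R * R] z by [].
have oT := @openT (R * R)%type.
have sf := @smooth_fst R setT; have ss := @smooth_snd R setT.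
have sff := smoothM oT sf sf; have sss := smoothM oT ss ss.
rewrite /cutoff (pdB b (@smooth_cst _ _ _ setT c) (smoothD oT sff sss) T).
rewrite (pdD b sff sss T) (pdM b sf sf T) (pdM b ss ss T) pd_cst pd_fst pd_snd.
by case: b => /=; ring.
Qed.

Lemma lap_cutoff c z : lap (cutoff c) z = - 4.
Proof.
have T : [set: R * R] z by [].
have oT := @openT (R * R)%type.
have sf := @smooth_fst R setT; have ss := @smooth_snd R setT.
have E b : pd b (pd b (cutoff c)) z = - 2.
  pose h : R * R -> R := if b then snd else fst.
  have sh : smooth_on setT h by rewrite /h; case: (b).
  rewrite (@eq_on_pd _ _ oT b _ (cst (- 2) * h) z)//; last first.
    by move=> y _; rewrite pd_cutoff /h; case: (b).
  rewrite (pdZ b _ sh T) /h; case: (b); first by rewrite pd_snd mulr1.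
  by rewrite pd_fst mulr1.
rewrite lapE (E false) (E true); ring.
Qed.

Lemma pd_cutoff2 c b z : pd b (cutoff2 c) z = - 4 * cutoff c z * coord b z.
Proof.
have T : [set: R * R] z by [].
have oT := @openT (R * R)%type.
have sc := smooth_cutoff c oT.
rewrite (pdM b sc sc T) pd_cutoff; ring.
Qed.

Lemma lap_cutoff2 c z : lap (cutoff2 c) z = - 8 * cutoff c z + 8 * sqn z.
Proof.
have T : [set: R * R] z by [].
have oT := @openT (R * R)%type.
have sc := smooth_cutoff c oT.
rewrite (lapM oT sc sc T) lap_cutoff !pd_cutoff /coord /sqn; ring.
Qed.

(* At the maximum of the quotient [cutoff2 c * A / w], of value [l], the
   function [l * w - cutoff2 c * A] has a local minimum. *)
Lemma cutoff_ratio_max (c : R) A w : 0 < c < 1 ->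
  smooth_on Disc A -> smooth_on Disc w -> (forall z, Disc z -> 0 < w z) ->
  exists l : R, [/\ 0 <= l, forall z, sqn z <= c -> cutoff2 c z * A z <= l * w z &
    l = 0 \/ exists z, [/\ sqn z < c, 0 < l,
      l * w z = cutoff2 c z * A z,
      forall b, l * pd b w z =
        cutoff2 c z * pd b A z + A z * pd b (cutoff2 c) z &
      cutoff2 c z * lap A z + A z * lap (cutoff2 c) z
        + 2 * (pd false (cutoff2 c) z * pd false A z
               + pd true (cutoff2 c) z * pd true A z) <= l * lap w z]].
Proof.
move=> /andP[c0 c1] sA sw w0; have oD := @open_unit_disc R.
have Kd z : sqn z <= c -> Disc z by move=> zc; rewrite unit_discE /=; exact: le_lt_trans c1.
pose P z := cutoff2 c z * A z / w z.
have cP : {within [set z | sqn z <= c], continuous P}.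
  apply: continuous_in_subspaceT => z; rewrite inE /= => zc.
  have dz := Kd _ zc.
  apply: cvgM.
    apply: cvgM; last exact: (smooth_continuous sA dz).
    exact: (smooth_continuous (smooth_cutoff2 c oD) dz).
  apply: cvgV; first by rewrite gt_eqF// w0.
  exact: (smooth_continuous sw dz).
have [|z0 + maxz] := compact_EVT_max _ (@compact_sqn_le R c) cP.
  by exists (0, 0); rewrite /= /sqn /= !mul0r addr0 ltW.
rewrite inE /= => z0c.
have Ple z : sqn z <= c -> cutoff2 c z * A z <= P z0 * w z.
  by move=> zc; have := maxz z (mem_set zc); rewrite {1}/P ler_pdivrMr//; exact/w0/Kd.
(* A maximum that is not positive is covered by [l = 0], without information at the maximum
   point. *)
have [P0|P0] := leP (P z0) 0.
  exists 0; split=> [//|z zc|]; last by left.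
  rewrite mul0r (le_trans (Ple z zc))// pmulr_lle0// w0//; exact: Kd.
exists (P z0); split=> [|//|]; first exact: ltW.
right; exists z0.
(* The cutoff vanishes on the circle, so a positive maximum is interior. *)
have z0c' : sqn z0 < c.
  rewrite lt_neqAle z0c andbT; apply/eqP => e; move: P0.
  have -> : P z0 = 0 by rewrite /P [cutoff2 c z0](_ : _ = cutoff c z0 * cutoff c z0)// cutoffE e subrr !mul0r.
  by rewrite ltxx.
have d0 := Kd _ z0c.
pose D' : set (R * R) := [set z | sqn z < c].
have oD' : open D' by exact: open_sqn_lt.
have sub : D' `<=` Disc by move=> z /ltW; exact: Kd.
have sA' : smooth_on D' A by apply: smooth_on_sub_eq sA.
have sw' : smooth_on D' w by apply: smooth_on_sub_eq sw.
have sE' := smooth_cutoff2 c oD'.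
have slw : smooth_on D' (cst (P z0) * w).
  by apply: smoothM => //; exact: smooth_cst.
have sEA : smooth_on D' (cutoff2 c * A) by apply: smoothM.
have eq0 : P z0 * w z0 = cutoff2 c z0 * A z0.
  by rewrite /P divfK// gt_eqF// w0.
have [] := @pd_lap_at_min _ _ oD' (cst (P z0) * w - cutoff2 c * A) z0
  (smoothB oD' slw sEA) z0c'.
  move=> y /ltW yc; rewrite [leLHS](_ : _ = 0); last first.
    by apply/eqP; rewrite subr_eq0; apply/eqP; exact: eq0.
  by rewrite subr_ge0; exact: Ple.
rewrite (lapB oD' slw sEA z0c') (lapZ oD' (P z0) sw' z0c').
rewrite (lapM oD' sE' sA' z0c') => pd0 lap0; split=> //.
  move=> b; apply/subr0_eq; rewrite -(pd0 b) (pdB b slw sEA z0c').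
  by rewrite (pdZ b (P z0) sw' z0c') (pdM b sE' sA' z0c').
by rewrite -subr_ge0.
Qed.

End MaximumPrinciple.

(** * The gradient estimate *)

Section Algebra.
Context {R : realType}.

Lemma normr_mul_le (a b c d : R) : `|a| <= c -> `|b| <= d -> `|a * b| <= c * d.
Proof. by move=> ac bd; rewrite normrM ler_pM. Qed.

(* At an interior maximum, of value [l], of [e^2 s / u], where [e] is the cutoff
   [1 / 2 - |z|^2] at [z = (x, y)]: [t = Lap u], [ls = Lap s], [(s0, s1) = grad s],
   [sg = sqrt s] and [dl = |Hess f|]. *)
Lemma ratio_bound_alg (K u e s sg dl l t s0 s1 ls x y : R) :
  1 <= K -> 0 <= e <= 1 / 2 -> 0 <= sg -> sg ^+ 2 = s -> 0 < u -> K * u <= 1 / 2 ->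
  0 <= dl -> `|s0| <= K * (sg * dl) -> `|s1| <= K * (sg * dl) ->
  dl ^+ 2 - K * s ^+ 2 <= ls -> t <= - s -> 0 < l -> l * u = e * e * s ->
  e = 1 / 2 - (x * x + y * y) ->
  e * e * ls + s * (- 8 * e + 8 * (x * x + y * y))
    + 2 * (- 4 * e * x * s0 + - 4 * e * y * s1) <= l * t ->
  l <= 128 * K ^+ 2 + 8.
Proof.
move=> K1 /andP[e0 e2] sg0 sgs u0 Ku dl0 hs0 hs1 hls ht l0 lu exy H.
have x1 : `|x| <= 1 by rewrite ler_norml; apply/andP; split; nra.
have y1 : `|y| <= 1 by rewrite ler_norml; apply/andP; split; nra.
have s_gt0 : 0 < s.
  have h : 0 < l * u by rewrite mulr_gt0.
  rewrite lt_neqAle -sgs sqr_ge0 andbT sgs eq_sym; apply/eqP => s0'.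
  by move: h; rewrite lu s0' mulr0 ltxx.
have xs0 : `|x * s0| <= K * (sg * dl) by rewrite -[leRHS]mul1r; exact: normr_mul_le.
have ys1 : `|y * s1| <= K * (sg * dl) by rewrite -[leRHS]mul1r; exact: normr_mul_le.
have h1 : - (16 * e * (K * (sg * dl))) <=
    2 * (- 4 * e * x * s0 + - 4 * e * y * s1).
  move: xs0 ys1; rewrite !ler_norml => /andP[_ a1] /andP[_ a2].
  have := ler_wpM2l e0 a1; have := ler_wpM2l e0 a2; nra.
(* Completing the square: the cross term is paid by the [e * e * dl ^+ 2] that [ls] supplies, at the
   price of [64 * K ^+ 2 * s]. *)
have h2 : 16 * e * (K * (sg * dl)) <= (e * dl) ^+ 2 + 64 * K ^+ 2 * s.
  by rewrite -sgs; have := sqr_ge0 (e * dl - 8 * K * sg); nra.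
have h3 : e * e * (dl ^+ 2 - K * s ^+ 2) <= e * e * ls.
  by apply: ler_wpM2l => //; rewrite mulr_ge0.
have h4 : - (4 * s) <= s * (- 8 * e + 8 * (x * x + y * y)) by nra.
(* The equation [l * u = e * e * s] at the maximum turns the quadratic term into [l * s * (K * u)],
   and smallness of [u] makes it half of the [l * s] that [l * t] provides. The other half gives the
   bound on [l], with twice the constants [64 * K ^+ 2] and [4]. *)
have h5 : e * e * (K * s ^+ 2) <= l * s / 2.
  rewrite (_ : e * e * (K * s ^+ 2) = (l * s) * (K * u)); last first.
    by rewrite (_ : l * s * (K * u) = l * u * (K * s)); [rewrite lu; ring|ring].
  apply: ler_wpM2l; last lra.
  by rewrite mulr_ge0// ltW.
have h6 : l * t <= - (l * s) by nra.
have h7 : l * s <= (128 * K ^+ 2 + 8) * s by nra.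
by rewrite -(ler_pM2r s_gt0).
Qed.

(* At an interior maximum of [e^2 (|grad u|^2 + s u) / u^2], after division by
   [u] or [u^2]: [p = grad u / u], [x = Hess u / u], [T = s / u], [S = grad s / u],
   [h = Lap u / u], [(h0, h1) = grad (Lap u) / u], [ls = Lap s / u],
   [d^2 = |Hess f|^2 / u], [v = grad (|grad u|^2 + s u) / u^2], [g = grad e] and
   [L = Lap (e^2)]. The gain comes from [XQ] below: since [Lap u] is small, the
   Hessian of [u] has two nearly opposite eigenvalues, of size about [Q]. *)
Lemma cheng_yau_alg (B e Q W T p0 p1 x00 x01 x11 S0 S1 d h h0 h1 g0 g1 L ls v0 v1 : R) :
  1 <= B -> 0 < e <= 1 / 4 -> Q = p0 ^+ 2 + p1 ^+ 2 -> W = Q + T -> 0 <= T <= B ->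
  0 <= d -> `|S0| <= B * d -> `|S1| <= B * d -> h = x00 + x11 -> - B <= h <= 0 ->
  `|h0| <= B * (d + 1) -> `|h1| <= B * (d + 1) -> d ^+ 2 - B <= ls ->
  `|g0| <= 1 -> `|g1| <= 1 -> `|L| <= 4 ->
  v0 = 2 * (p0 * x00 + p1 * x01) + S0 + T * p0 ->
  v1 = 2 * (p0 * x01 + p1 * x11) + S1 + T * p1 ->
  2 * W * p0 * e = v0 * e + 2 * W * g0 ->
  2 * W * p1 * e = v1 * e + 2 * W * g1 ->
  e ^+ 2 * (2 * (x00 ^+ 2 + 2 * x01 ^+ 2 + x11 ^+ 2) + 2 * (p0 * h0 + p1 * h1)
    + ls + 2 * (p0 * S0 + p1 * S1) + T * h) + W * L
    + 2 * (2 * e * g0 * v0 + 2 * e * g1 * v1) <= e ^+ 2 * (W * (2 * Q + 2 * h)) ->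
  e ^+ 2 * Q <= (100 * B ^+ 2) ^+ 2.
Proof.
move=> B1 /andP[e0 e4] QE WE /andP[T0 TB] d0 hS0 hS1 hE /andP[hB h_le0] hh0 hh1 hls.
move=> hg0 hg1 hL v0E v1E b0 b1 H.
have Q0 : 0 <= Q by rewrite QE addr_ge0// sqr_ge0.
pose q := Num.sqrt Q.
have q0 : 0 <= q by exact: sqrtr_ge0.
have qQ : q ^+ 2 = Q by rewrite sqr_sqrtr.
have p0q : `|p0| <= q by rewrite -sqrtr_sqr ler_wsqrtr// QE lerDl sqr_ge0.
have p1q : `|p1| <= q by rewrite -sqrtr_sqr ler_wsqrtr// QE lerDr sqr_ge0.
have sq_le (a b : R) : 0 <= a -> a <= b -> a ^+ 2 <= b ^+ 2.
  by move=> a0 ab; rewrite !expr2; exact: ler_pM.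
suff eq_le : e * q <= 100 * B ^+ 2.
  by rewrite -qQ -exprMn; apply: sq_le eq_le; exact: mulr_ge0 (ltW e0) q0.
(* Suppose [e * q > 100 * B ^+ 2]. As [e <= 1 / 4], [q] exceeds both [400 * B ^+ 2] and [100 / e],
   so the error terms, with their factors [B] and [1 / e], cost only a small fraction of [Q ^+ 2],
   apart from terms in [d]. *)
rewrite leNgt; apply/negP => qL.
pose i := e^-1.
have i0 : 0 < i by rewrite invr_gt0.
have ei : e * i = 1 by rewrite mulfV// gt_eqF.
have i4 : 4 <= i.
  have a := ler_wpM2l (ltW i0) e4; rewrite (mulrC i e) ei in a; clear - a; lra.
have iq : 100 * B ^+ 2 * i <= q.
  rewrite (_ : q = e * q * i); last by rewrite mulrAC ei mul1r.
  by apply: ler_wpM2r; exact: ltW.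
have BB : B <= B ^+ 2 by rewrite expr2 ler_peMl// (le_trans ler01).
have BB1 : 1 <= B ^+ 2 by exact: le_trans BB.
have q4 : 400 * B ^+ 2 <= q.
  have a := ler_wpM2l (le_trans ler01 BB1) i4; clear - a iq; lra.
have q1 : 400 <= q by clear - q4 BB1; lra.
have iq' : 100 * i <= q.
  have a := ler_wpM2r (ltW i0) BB1; clear - a iq; lra.
have qQ1 : 400 * q <= Q by rewrite -qQ expr2; exact: ler_wpM2r.
have QQ : 400 * Q <= Q ^+ 2.
  by rewrite expr2; apply: ler_wpM2r => //; clear - qQ1 q1; lra.
have W0 : 0 <= W by rewrite WE addr_ge0.
have WQ : W <= Q + Q / 100 by rewrite WE; clear - TB BB q4 qQ1 q1; lra.
have WB : W <= Q + B by rewrite WE; clear - TB; lra.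
(* The critical point equations are solved for [v0] and [v1]. This removes them from the cutoff
   terms, and later determines the Hessian in the direction [p]. *)
have v0W : v0 = 2 * W * p0 - 2 * W * g0 * i.
  have -> : v0 = v0 * e * i by rewrite -mulrA ei mulr1.
  rewrite (_ : v0 * e = 2 * W * p0 * e - 2 * W * g0); last by rewrite b0 addrK.
  by rewrite mulrBl -(mulrA (2 * W * p0)) ei mulr1.
have v1W : v1 = 2 * W * p1 - 2 * W * g1 * i.
  have -> : v1 = v1 * e * i by rewrite -mulrA ei mulr1.
  rewrite (_ : v1 * e = 2 * W * p1 * e - 2 * W * g1); last by rewrite b1 addrK.
  by rewrite mulrBl -(mulrA (2 * W * p1)) ei mulr1.
pose X := x00 ^+ 2 + 2 * x01 ^+ 2 + x11 ^+ 2.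
have Hi : 2 * X <= W * (2 * Q + 2 * h) - 2 * (p0 * h0 + p1 * h1) - ls
    - 2 * (p0 * S0 + p1 * S1) - T * h - W * L * i ^+ 2
    - 4 * i * (g0 * v0 + g1 * v1).
  have e2 : 0 < e ^+ 2 by rewrite exprn_gt0.
  rewrite -(ler_pM2l e2).
  have -> : e ^+ 2 * (W * (2 * Q + 2 * h) - 2 * (p0 * h0 + p1 * h1) - ls
    - 2 * (p0 * S0 + p1 * S1) - T * h - W * L * i ^+ 2
    - 4 * i * (g0 * v0 + g1 * v1)) = e ^+ 2 * (W * (2 * Q + 2 * h)) -
    e ^+ 2 * (2 * (p0 * h0 + p1 * h1) + ls + 2 * (p0 * S0 + p1 * S1) + T * h) -
    (e * i) ^+ 2 * (W * L) - (e * i) * (4 * e * (g0 * v0 + g1 * v1)) by ring.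
  rewrite ei expr1n !mul1r; rewrite -/X in H; clear - H; lra.
have ph : `|p0 * h0| <= q * (B * (d + 1)) by exact: normr_mul_le.
have ph' : `|p1 * h1| <= q * (B * (d + 1)) by exact: normr_mul_le.
have pS : `|p0 * S0| <= q * (B * d) by exact: normr_mul_le.
have pS' : `|p1 * S1| <= q * (B * d) by exact: normr_mul_le.
have gp : `|g0 * p0| <= 1 * q by exact: normr_mul_le.
have gp' : `|g1 * p1| <= 1 * q by exact: normr_mul_le.
have gg : `|g0 * g0| <= 1 * 1 by exact: normr_mul_le.
have gg' : `|g1 * g1| <= 1 * 1 by exact: normr_mul_le.
rewrite !ler_norml in ph ph' pS pS' gp gp' gg gg' hL.
move/andP: ph => [ph1 ph2]; move/andP: ph' => [ph1' ph2'].
move/andP: pS => [pS1 pS2]; move/andP: pS' => [pS1' pS2'].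
move/andP: gp => [gp1 gp2]; move/andP: gp' => [gp1' gp2'].
move/andP: gg => [gg1 gg2]; move/andP: gg' => [gg1' gg2'].
move/andP: hL => [L1 L2].
have Wi0 : 0 <= W * i by rewrite mulr_ge0// ltW.
have Wii0 : 0 <= W * i ^+ 2 by rewrite mulr_ge0// sqr_ge0.
have gv : - (16 * (W * i) * q) - 16 * (W * i ^+ 2) <= 4 * i * (g0 * v0 + g1 * v1).
  have -> : 4 * i * (g0 * v0 + g1 * v1) = 8 * (W * i) * (g0 * p0 + g1 * p1)
    - 8 * (W * i ^+ 2) * (g0 * g0 + g1 * g1) by rewrite v0W v1W; ring.
  have a1 := ler_wpM2l Wi0 (lerD gp1 gp1').
  have a2 := ler_wpM2l Wii0 (lerD gg2 gg2').
  clear - a1 a2; lra.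
have WL : - (4 * (W * i ^+ 2)) <= W * L * i ^+ 2.
  have -> : W * L * i ^+ 2 = W * i ^+ 2 * L by ring.
  have a := ler_wpM2l Wii0 L1; clear - a; lra.
have Wh : W * (2 * Q + 2 * h) <= 2 * Q ^+ 2 + 2 * B * Q.
  have a1 : W * h <= 0 by rewrite mulr_ge0_le0.
  have a2 := ler_wpM2r Q0 WB; clear - a1 a2; lra.
have Th : - (T * h) <= B ^+ 2.
  have a : T * - h <= B * B.
    by apply: ler_pM => //; [rewrite oppr_ge0|rewrite lerNl].
  clear - a; lra.
have Wiq : 100 * (W * i * q) <= (Q + Q / 100) * Q.
  have -> : 100 * (W * i * q) = W * (100 * i * q) by ring.
  apply: ler_pM => //; first by rewrite !mulr_ge0// ltW.
  by rewrite -qQ expr2; apply: ler_wpM2r.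
have Wii : 100 * (W * i ^+ 2) <= W * i * q.
  have -> : 100 * (W * i ^+ 2) = W * i * (100 * i) by ring.
  exact: ler_wpM2l.
have BBQ : B ^+ 2 * Q <= Q ^+ 2 / 400.
  have a : 400 * B ^+ 2 <= Q by clear - qQ1 q4 q1; lra.
  have := ler_wpM2r Q0 a; clear; lra.
have BQ : B * Q <= Q ^+ 2 / 400.
  by apply: le_trans BBQ; exact: ler_wpM2r.
have qBd : 8 * (q * (B * d)) <= d ^+ 2 / 2 + 32 * (B ^+ 2 * Q).
  by rewrite -qQ; have := sqr_ge0 (d - 8 * q * B); clear; nra.
have qB : q * B <= Q ^+ 2 / 400.
  have a := ler_wpM2l q0 BB; have b : 400 * (q * B ^+ 2) <= Q.
    by rewrite mulrCA -qQ expr2 ler_wpM2l.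
  clear - a b QQ q1 qQ1; lra.
have QQ0 := sqr_ge0 Q.
(* The leading term is [2 * Q ^+ 2]. Of the [d ^+ 2] in [ls], half absorbs the products
   [q * (B * d)], and the other half is kept for the final comparison. *)
have up : 2 * X <= 24 / 10 * Q ^+ 2 - d ^+ 2 / 2.
  have qBd1 : q * (B * (d + 1)) = q * (B * d) + q * B by ring.
  have BQ2 : B + B ^+ 2 <= Q ^+ 2 / 100 by clear - BB q4 qQ1 QQ q1; lra.
  clear - QQ0 Hi Wh ph1 ph1' qBd1 hls pS1 pS1' Th WL gv Wiq Wii qBd qB BQ2 BQ BBQ d0; lra.
(* [al] is the Hessian form evaluated at [(p, p)]. Pairing the critical point equations with [p]
   shows that it is about [W * Q], hence nearly at least [Q ^+ 2]. *)
pose al := p0 * (p0 * x00 + p1 * x01) + p1 * (p0 * x01 + p1 * x11).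
have alE : 2 * al = 2 * W * Q - 2 * (W * i) * (g0 * p0 + g1 * p1)
    - (p0 * S0 + p1 * S1) - T * Q.
  have : v0 * p0 + v1 * p1 = 2 * al + (p0 * S0 + p1 * S1) + T * Q.
    by rewrite v0E v1E QE /al; ring.
  have -> : v0 * p0 + v1 * p1 = 2 * W * Q - 2 * (W * i) * (g0 * p0 + g1 * p1).
    by rewrite v0W v1W QE; ring.
  clear; lra.
have al_ge : (97 / 100) * Q ^+ 2 - q * (B * d) <= al.
  have a1 := ler_wpM2l Wi0 (lerD gp2 gp2').
  have a2 : Q ^+ 2 <= W * Q by rewrite expr2 ler_wpM2r// WE lerDl.
  have a3 : T * Q <= B * Q by rewrite ler_wpM2r.
  clear - QQ0 a1 a2 a3 alE pS2 pS2' BQ Wiq; lra.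
(* In the orthonormal frame along and across [p], the Hessian has diagonal entries [al / Q] and
   [h - al / Q]; the discarded square comes from the off-diagonal entry. *)
have XQ : al ^+ 2 + (al - h * Q) ^+ 2 <= Q ^+ 2 * X.
  have -> : Q ^+ 2 * X = al ^+ 2 + (al - h * Q) ^+ 2 +
      2 * (p0 * (p0 * x01 + p1 * x11) - p1 * (p0 * x00 + p1 * x01)) ^+ 2.
    by rewrite hE QE /X /al; ring.
  by rewrite lerDl mulr_ge0// sqr_ge0.
pose A0 := (97 / 100) * Q ^+ 2.
have A00 : 0 <= A0 by rewrite /A0 mulr_ge0 ?sqr_ge0//; clear; lra.
(* Both squares in [XQ] are bounded below by their tangents at [A0], so the sign of [al] does not
   matter; [h <= 0] allows [al - h * Q] to be replaced by [al]. *)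
have low : 4 * A0 ^+ 2 - 8 * A0 * (q * (B * d)) <= 2 * (Q ^+ 2 * X).
  have a1 := sqr_ge0 (al - A0); have a2 := sqr_ge0 (al - h * Q - A0).
  have a3 : 0 <= A0 * (- h * Q) by rewrite mulr_ge0// mulr_ge0// oppr_ge0.
  have a4 := ler_wpM2l A00 al_ge; rewrite -/A0 in a4.
  clear - a1 a2 a3 a4 XQ; lra.
have Qpos : 0 < Q by clear - qQ1 q1; lra.
have Q2 : 0 < Q ^+ 2 by rewrite exprn_gt0.
have low' : 376 / 100 * Q ^+ 2 - 776 / 100 * (q * (B * d)) <= 2 * X.
  rewrite -(ler_pM2l Q2); apply: le_trans (le_trans _ low) _.
    by rewrite /A0; have := sqr_ge0 (Q ^+ 2); clear; lra.
  by rewrite mulrCA.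
have qBd0 : 0 <= q * (B * d) by rewrite !mulr_ge0// (le_trans ler01).
(* The coefficients [3.76] and [2.4] of [Q ^+ 2] contradict each other: by [qBd] the product with
   [d] costs less than the [d ^+ 2 / 2] kept in [up] and a small multiple of [Q ^+ 2]. *)
clear - up low' qBd BBQ qBd0 Qpos QQ q1 qQ1; lra.
Qed.

End Algebra.

Section GradientBound.
Context {R : realType}.

(** Normalization: division by powers of [U] brings the data at the maximum into the form of
    [cheng_yau_alg]. The hypothesis [s <= C * U] is what bounds [s / U] and [t / U], and [B] is
    chosen to dominate [3 * C] and [K * (1 + C) ^+ 2]. *)
Lemma cheng_yau_raw (K C B U s sg dl e x y u0 u1 u00 u01 u11 s0 s1 t t0 t1 ls l V0 V1 LV N : R) :
  1 <= K -> 0 <= C -> B = 3 * K * (1 + C) ^+ 2 -> 0 < U <= 1 -> 0 <= s <= C * U ->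
  0 <= sg -> sg ^+ 2 = s -> 0 <= dl -> 0 < e -> e = 1 / 4 - (x * x + y * y) ->
  `|s0| <= K * (sg * dl) -> `|s1| <= K * (sg * dl) ->
  - (3 * s) <= t <= - s -> t = u00 + u11 -> dl ^+ 2 - K * s ^+ 2 <= ls ->
  `|t0| <= K * (sg * dl + sg * s) -> `|t1| <= K * (sg * dl + sg * s) ->
  N = u0 * u0 + u1 * u1 ->
  V0 = 2 * (u0 * u00 + u1 * u01) + (s * u0 + U * s0) ->
  V1 = 2 * (u0 * u01 + u1 * u11) + (s * u1 + U * s1) ->
  LV = 2 * (u0 * t0 + u1 * t1) + 2 * (u00 ^+ 2 + 2 * u01 ^+ 2 + u11 ^+ 2)
    + (s * t + U * ls + 2 * (s0 * u0 + s1 * u1)) ->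
  l * (U * U) = e * e * (N + s * U) ->
  l * (2 * (U * u0)) = e * e * V0 + (N + s * U) * (- 4 * e * x) ->
  l * (2 * (U * u1)) = e * e * V1 + (N + s * U) * (- 4 * e * y) ->
  e * e * LV + (N + s * U) * (- 8 * e + 8 * (x * x + y * y))
   + 2 * (- 4 * e * x * V0 + - 4 * e * y * V1) <= l * (2 * (U * t) + 2 * N) ->
  l <= (100 * B ^+ 2) ^+ 2 + B.
Proof.
move=> K1 C0 BE /andP[U0 U1] /andP[s_ge0 sC] sg0 sgs dl0 e0 eE hs0 hs1 /andP[t3 ts] tE hls.
move=> ht0 ht1 NE V0E V1E LVE lE b0 b1 H.
have Un0 : U != 0 by rewrite gt_eqF.
have en0 : e != 0 by rewrite gt_eqF.
(* [sg] and [dl] are linear in the disc while [U] is quadratic, so they are divided by [sqrt U]; a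
   product [sg * dl] is then divided by [U], like the derivatives that it bounds. *)
pose r := Num.sqrt U.
have r0 : 0 < r by rewrite sqrtr_gt0.
have rr : r * r = U by rewrite -expr2 sqr_sqrtr// ltW.
have rn0 : r != 0 by rewrite gt_eqF.
have r1 : r <= 1 by rewrite -sqrtr1 ler_wsqrtr.
pose tau := sg / r.
have tau0 : 0 <= tau by rewrite divr_ge0// ltW.
have tauE : sg = tau * r by rewrite divfK.
pose T := s / U.
have T0 : 0 <= T by rewrite divr_ge0// ltW.
have TC : T <= C by rewrite ler_pdivrMr.
have sT : s = T * U by rewrite divfK.
have tauT : tau ^+ 2 = T by rewrite /tau expr_div_n sgs expr2 rr.
have tauC : tau <= 1 + C by clear - tau0 tauT TC; nra.
pose d := dl / r.
have d0 : 0 <= d by rewrite divr_ge0// ltW.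
have dE : dl = d * r by rewrite divfK.
have C1 : 1 <= 1 + C by lra.
have C2 : 1 + C <= (1 + C) ^+ 2 by rewrite expr2 ler_peMl// (le_trans ler01).
have KB : K * (1 + C) ^+ 2 <= B.
  by rewrite BE -mulrA ler_peMl//; [rewrite mulr_ge0 ?sqr_ge0// (le_trans ler01)|lra].
have KC : K * (1 + C) <= K * (1 + C) ^+ 2 by rewrite ler_wpM2l// (le_trans ler01).
have K0 : 0 <= K by exact: le_trans K1.
have C3 : 3 * (1 + C) ^+ 2 <= B.
  by rewrite BE mulrAC ler_peMr// mulr_ge0 ?sqr_ge0.
have Kt : K * tau <= K * (1 + C) by rewrite ler_wpM2l.
have KtT : K * (tau * T) <= K * (1 + C) ^+ 2.
  by rewrite ler_wpM2l// expr2 ler_pM// (le_trans TC)// lerDr.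
have B1 : 1 <= B by clear - C1 C2 C3; lra.
have x2 : x * x + y * y < 1 / 4 by clear - e0 eE; lra.
have xb : `|- 2 * x| <= 1 by rewrite ler_norml; apply/andP; clear - x2; split; nra.
have yb : `|- 2 * y| <= 1 by rewrite ler_norml; apply/andP; clear - x2; split; nra.
have q0 : 0 <= x * x + y * y by rewrite addr_ge0// -expr2 sqr_ge0.
have bound (a : R) : `|a| <= K * (sg * dl) -> `|a / U| <= B * d.
  move=> h; rewrite normrM normfV (gtr0_norm U0) ler_pdivrMr//.
  apply: le_trans h _; rewrite tauE dE -rr.
  have -> : K * (tau * r * (d * r)) = K * tau * (d * (r * r)) by ring.
  rewrite -[leRHS]mulrA ler_wpM2r//; last by clear - Kt KC KB; lra.
  by rewrite mulr_ge0// rr ltW.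
have bound' (a : R) : `|a| <= K * (sg * dl + sg * s) -> `|a / U| <= B * (d + 1).
  move=> h; rewrite normrM normfV (gtr0_norm U0) ler_pdivrMr//.
  apply: le_trans h _; rewrite sT tauE dE.
  have -> : K * (tau * r * (d * r) + tau * r * (T * U)) =
    (K * tau * d + K * (tau * T) * r) * U by rewrite -rr; ring.
  apply: ler_wpM2r; first exact: ltW.
  rewrite mulrDr; apply: lerD; first by apply: ler_wpM2r => //; clear - Kt KC KB; lra.
  apply: ler_pM => //.
  - by apply: mulr_ge0 => //; exact: mulr_ge0.
  - exact: ltW.
  - by clear - KtT KB; lra.
pose Q := (u0 / U) ^+ 2 + (u1 / U) ^+ 2.
have QN : Q * (U * U) = N by rewrite /Q NE; field.
have lW : l = e ^+ 2 * (Q + T).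
  have UU : U * U != 0 by rewrite mulf_neq0.
  apply: (mulIf UU); rewrite lE -QN {1}sT; ring.
have key : e ^+ 2 * Q <= (100 * B ^+ 2) ^+ 2.
  apply: (@cheng_yau_alg R B e Q (Q + T) T (u0 / U) (u1 / U) (u00 / U) (u01 / U) (u11 / U)
    (s0 / U) (s1 / U) d (t / U) (t0 / U) (t1 / U) (- 2 * x) (- 2 * y)
    (- 8 * e + 8 * (x * x + y * y)) (ls / U) (V0 / (U * U)) (V1 / (U * U))) => //.
  - by rewrite e0 eE; clear - q0; lra.
  - by rewrite T0; clear - TC C3 C2 C0; lra.
  - exact: bound.
  - exact: bound.
  - by rewrite tE mulrDl.
  - apply/andP; split.
      rewrite ler_pdivlMr// mulNr; apply: le_trans t3; rewrite lerN2 {1}sT mulrA.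
      by apply: ler_wpM2r; [exact: ltW|clear - TC C3 C2 C0; lra].
    by rewrite pmulr_lle0 ?invr_gt0//; clear - ts s_ge0; lra.
  - exact: bound'.
  - exact: bound'.
  - rewrite ler_pdivlMr//; apply: le_trans hls.
    have -> : dl ^+ 2 = d ^+ 2 * U by rewrite dE -rr; ring.
    rewrite mulrBl lerD2l lerN2.
    have -> : K * s ^+ 2 = K * (T ^+ 2 * U) * U by rewrite sT; ring.
    apply: ler_wpM2r; first exact: ltW.
    apply: le_trans KB; apply: ler_wpM2l => //.
    have a : T ^+ 2 * U <= T ^+ 2 by rewrite ler_piMr// sqr_ge0.
    apply: le_trans a _; rewrite !expr2; apply: ler_pM => //; clear - TC; lra.
  - by rewrite ler_norml eE; clear - q0 x2; apply/andP; split; lra.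
  - by rewrite V0E /T; field.
  - by rewrite V1E /T; field.
  - have UU : U * U * e != 0 by rewrite !mulf_neq0.
    apply: (mulIf UU).
    have -> : 2 * (Q + T) * (u0 / U) * e * (U * U * e) = l * (2 * (U * u0)).
      by rewrite lW; field.
    rewrite b0.
    have -> : N + s * U = (Q + T) * (U * U) by rewrite -QN {1}sT; ring.
    by field.
  - have UU : U * U * e != 0 by rewrite !mulf_neq0.
    apply: (mulIf UU).
    have -> : 2 * (Q + T) * (u1 / U) * e * (U * U * e) = l * (2 * (U * u1)).
      by rewrite lW; field.
    rewrite b1.
    have -> : N + s * U = (Q + T) * (U * U) by rewrite -QN {1}sT; ring.
    by field.
  - have UU : 0 < U * U by rewrite mulr_gt0.
    rewrite -(ler_pM2r UU).
    have -> : e ^+ 2 * ((Q + T) * (2 * Q + 2 * (t / U))) * (U * U) =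
        l * (2 * (U * t) + 2 * N).
      by rewrite lW -QN; field.
    apply: le_trans H; rewrite le_eqVlt; apply/orP; left; apply/eqP.
    have -> : N + s * U = (Q + T) * (U * U) by rewrite -QN {1}sT; ring.
    by rewrite LVE /T; field.
rewrite lW mulrDr; apply: lerD => //.
have e1 : e ^+ 2 <= 1 by rewrite expr_le1//; [rewrite eE; clear - q0; lra|exact: ltW].
have TB : T <= B by clear - TC C3 C2 C0; lra.
by apply: le_trans TB; rewrite ler_piMl.
Qed.

(** The same estimate with its expressions spelled exactly as [pdM] and [lapM] produce them, so that
    it applies to values of derivatives without further algebra on them. *)
Lemma cheng_yau_jet (K C B U s sg dl e x y u0 u1 u00 u01 u11 s0 s1 t t0 t1 ls l : R) :
  1 <= K -> 0 <= C -> B = 3 * K * (1 + C) ^+ 2 -> 0 < U <= 1 -> 0 <= s <= C * U ->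
  0 <= sg -> sg ^+ 2 = s -> 0 <= dl -> 0 < e -> e = 1 / 4 - (x * x + y * y) ->
  `|s0| <= K * (sg * dl) -> `|s1| <= K * (sg * dl) ->
  - (3 * s) <= t <= - s -> t = u00 + u11 -> dl ^+ 2 - K * s ^+ 2 <= ls ->
  `|t0| <= K * (sg * dl + sg * s) -> `|t1| <= K * (sg * dl + sg * s) ->
  l * (U * U) = e * e * (u0 * u0 + u1 * u1 + s * U) ->
  let V0 := u0 * u00 + u0 * u00 + (u1 * u01 + u1 * u01) + (s * u0 + U * s0) in
  let V1 := u0 * u01 + u0 * u01 + (u1 * u11 + u1 * u11) + (s * u1 + U * s1) in
  l * (U * u0 + U * u0) = e * e * V0
    + (u0 * u0 + u1 * u1 + s * U) * (- 4 * e * x) ->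
  l * (U * u1 + U * u1) = e * e * V1
    + (u0 * u0 + u1 * u1 + s * U) * (- 4 * e * y) ->
  e * e * (u0 * t0 + u0 * t0 + 2 * (u00 * u00 + u01 * u01)
      + (u1 * t1 + u1 * t1 + 2 * (u01 * u01 + u11 * u11))
      + (s * t + U * ls + 2 * (s0 * u0 + s1 * u1)))
    + (u0 * u0 + u1 * u1 + s * U) * (- 8 * e + 8 * (x * x + y * y))
    + 2 * (- 4 * e * x * V0 + - 4 * e * y * V1)
    <= l * (U * t + U * t + 2 * (u0 * u0 + u1 * u1)) ->
  l <= (100 * B ^+ 2) ^+ 2 + B.
Proof.
move=> K1 C0 BE U0 sC sg0 sgs dl0 e0 eE hs0 hs1 ht tE hls ht0 ht1 lE V0 V1 b0 b1 H.
have dbl (a : R) : 2 * a = a + a by rewrite mulr_natl mulr2n.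
have V0E : V0 = 2 * (u0 * u00 + u1 * u01) + (s * u0 + U * s0).
  by clear; rewrite /V0; ring.
have V1E : V1 = 2 * (u0 * u01 + u1 * u11) + (s * u1 + U * s1).
  by clear; rewrite /V1; ring.
rewrite -dbl in b0; rewrite -dbl in b1; rewrite -(dbl (U * t)) in H.
move: H; rewrite [X in _ * X + _](_ : _ = 2 * (u0 * t0 + u1 * t1)
  + 2 * (u00 ^+ 2 + 2 * u01 ^+ 2 + u11 ^+ 2)
  + (s * t + U * ls + 2 * (s0 * u0 + s1 * u1))); last by clear; ring.
exact: (cheng_yau_raw K1 C0 BE U0 sC sg0 sgs dl0 e0 eE hs0 hs1 ht tE hls ht0 ht1
  erefl V0E V1E erefl lE b0 b1).
Qed.

End GradientBound.

Section Gradient.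
Context {R : realType}.
Local Notation Disc := (@unit_disc R).

Lemma Disc_lt (c : R) (z : R * R) : c <= 1 -> sqn z < c -> Disc z.
Proof. by move=> c1 zc; rewrite unit_discE; exact: lt_le_trans c1. Qed.

Lemma Disc_le (c : R) (z : R * R) : c < 1 -> sqn z <= c -> Disc z.
Proof. by move=> c1 zc; rewrite unit_discE; exact: le_lt_trans c1. Qed.

Lemma sqn_ge0 (z : R * R) : 0 <= sqn z.
Proof. by rewrite addr_ge0// -expr2 sqr_ge0. Qed.

Lemma cutoff_itv (c : R) (z : R * R) : sqn z < c -> 0 <= cutoff c z <= c.
Proof.
by move=> zc; rewrite cutoffE subr_ge0 ltW//= gerBl sqn_ge0.
Qed.

Lemma center_ineq_alg (L l e s U N0 N1 : R) : l <= L -> e = 1 / 4 -> 0 < U ->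
  0 <= s -> e * e * (N0 * N0 + N1 * N1 + s * U) <= l * (U * U) ->
  N0 ^+ 2 <= 16 * L * U ^+ 2 /\ N1 ^+ 2 <= 16 * L * U ^+ 2.
Proof.
move=> lL -> U0 s0 h; have U2 : 0 <= U * U by rewrite -expr2 sqr_ge0.
have h1 := ler_wpM2r U2 lL; have h2 : 0 <= s * U by rewrite mulr_ge0// ltW.
have := sqr_ge0 N0; have := sqr_ge0 N1; split; lra.
Qed.

Lemma half_cutoff_alg (M l q s U : R) : q <= 1 / 4 -> 0 <= s -> 0 < U -> l <= M ->
  (1 / 2 - q) * (1 / 2 - q) * s <= l * U -> s <= 16 * M * U.
Proof.
move=> q4 s0 U0 lM h.
have a : 1 / 16 <= (1 / 2 - q) * (1 / 2 - q) by nra.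
have := ler_wpM2r s0 a; have := ler_wpM2r (ltW U0) lM; lra.
Qed.

Lemma half_itv : 0 < (1 / 2 : R) < 1.
Proof. by apply/andP; split; lra. Qed.

Lemma quarter_itv : 0 < (1 / 4 : R) < 1.
Proof. by apply/andP; split; lra. Qed.

Lemma quarter_half : (1 / 4 : R) <= 1 / 2.
Proof. lra. Qed.

Lemma small_le1 (k x : R) : 1 <= k -> 0 < x -> k * x <= 1 / 2 -> x <= 1.
Proof. nra. Qed.

(* [s] and [dl] stand for the squared gradient and the norm of the Hessian of a
   disc. *)
Record gradient_ineqs (K : R) (u s dl : R * R -> R) (z : R * R) : Prop :=
  GradientIneqs {
    gi_u_gt0 : 0 < u z ;
    gi_u_small : K * u z <= 1 / 2 ;
    gi_s_ge0 : 0 <= s z ;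
    gi_dl_ge0 : 0 <= dl z ;
    gi_lap_u : - (3 * s z) <= lap u z <= - s z ;
    gi_pd_s : forall b, `|pd b s z| <= K * (Num.sqrt (s z) * dl z) ;
    gi_lap_s : dl z ^+ 2 - K * s z ^+ 2 <= lap s z ;
    gi_pd_lap_u : forall b,
      `|pd b (lap u) z| <= K * (Num.sqrt (s z) * dl z + Num.sqrt (s z) * s z) }.

Variables (K : R) (u s dl : R * R -> R).
Hypotheses (K1 : 1 <= K) (su : smooth_on Disc u) (ss : smooth_on Disc s).
Hypothesis (gi : forall z, Disc z -> gradient_ineqs K u s dl z).

Lemma ratio_bound z : sqn z <= 1 / 4 -> s z <= 16 * (128 * K ^+ 2 + 8) * u z.
Proof.
move=> z4.
have /andP[_ c2] := quarter_itv; have /andP[_ c2'] := half_itv.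
have c1 := half_itv.
have u0 z' : Disc z' -> 0 < u z' by move=> /gi [].
have [l [l0 lle lcase]] := cutoff_ratio_max c1 ss su u0.
have L0 : 0 <= 128 * K ^+ 2 + 8 by rewrite addr_ge0// mulr_ge0// sqr_ge0.
have lL : l <= 128 * K ^+ 2 + 8.
  case: lcase => [->//|[z0 [z0c lpos lE _ H]]].
  have dz0 := Disc_lt (ltW c2') z0c.
  have [g1 g2 g3 g4 /andP[_ g5] g6 g7 _] := gi dz0.
  have sqs : Num.sqrt (s z0) ^+ 2 = s z0 by rewrite sqr_sqrtr.
  move: H; rewrite lap_cutoff2 !pd_cutoff2 [cutoff2 _ _](_ : _ = cutoff (1 / 2) z0 * cutoff (1 / 2) z0)// => H.
  have e2 := cutoff_itv z0c.
  exact: (ratio_bound_alg K1 e2 (sqrtr_ge0 _) sqs g1 g2 g4 (g6 false) (g6 true) g7 g5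
    lpos lE (cutoffE _ _) H).
have dz := Disc_le c2 z4.
have [uz _ sz _ _ _ _ _] := gi dz.
have := lle z (le_trans z4 quarter_half).
rewrite [cutoff2 _ _](_ : _ = cutoff (1 / 2) z * cutoff (1 / 2) z)// cutoffE.
exact: half_cutoff_alg z4 sz uz lL.
Qed.

(** The outer [16] undoes the squared cutoff [1 / 16] at the centre, the inner
    [16 * (128 * K ^+ 2 + 8)] is the constant of [ratio_bound], and the rest is the bound of
    [cheng_yau_jet]. Only [K] enters, so all discs share the constant. *)
Definition gradient_const : R :=
  let B := 3 * K * (1 + 16 * (128 * K ^+ 2 + 8)) ^+ 2 in
  16 * ((100 * B ^+ 2) ^+ 2 + B).

Lemma gradient_const_gt0 : 0 < gradient_const.
Proof.
have K0 : 0 < K by exact: lt_le_trans K1.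
have c0 : 0 < 1 + 16 * (128 * K ^+ 2 + 8).
  by rewrite addr_gt0// mulr_gt0// addr_gt0// mulr_gt0// exprn_gt0.
rewrite /gradient_const /= mulr_gt0// addr_gt0//.
  by rewrite exprn_gt0// mulr_gt0// exprn_gt0// !mulr_gt0// exprn_gt0.
by rewrite !mulr_gt0// exprn_gt0.
Qed.

(** The maximum principle for [cutoff2 (1 / 4) * V / (u * u)] bounds this quotient by [l]; at the
    centre the cutoff is [1 / 4] and [V] dominates the squared gradient. *)
Lemma gradient_bound b : pd b u (0, 0) ^+ 2 <= gradient_const * u (0, 0) ^+ 2.
Proof.
have oD := @open_unit_disc R.
pose V : R * R -> R := (pd false u * pd false u + pd true u * pd true u) + s * u.
have su0 := smooth_pd false su; have su1 := smooth_pd true su.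
have s00 := smoothM oD su0 su0; have s11 := smoothM oD su1 su1.
have sN := smoothD oD s00 s11; have sV2 := smoothM oD ss su.
have sV : smooth_on Disc V := smoothD oD sN sV2.
have sw := smoothM oD su su.
have c1 := quarter_itv; have /andP[c0 c2] := c1.
have u0 z : Disc z -> 0 < (u * u) z.
  by move=> /gi [g _ _ _ _ _ _ _]; exact: mulr_gt0.
have [l [l0 lle lcase]] := cutoff_ratio_max c1 sV sw u0.
pose C1 := 16 * (128 * K ^+ 2 + 8).
pose B := 3 * K * (1 + C1) ^+ 2.
have C10 : 0 <= C1 by rewrite mulr_ge0// addr_ge0// mulr_ge0// sqr_ge0.
have lB : l <= (100 * B ^+ 2) ^+ 2 + B.
  case: lcase => [->|[z [zc lpos lE lpd H]]].
    have K0 : 0 <= K by exact: le_trans K1.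
    have B0 : 0 <= B by apply: mulr_ge0 (sqr_ge0 _); exact: mulr_ge0.
    by apply: addr_ge0 => //; exact: sqr_ge0.
  have dz := Disc_lt (ltW c2) zc.
  have [g1 g2 g3 g4 g5 g6 g7 g8] := gi dz.
  have sqs : Num.sqrt (s z) ^+ 2 = s z by rewrite sqr_sqrtr.
  have VE : V z = pd false u z * pd false u z + pd true u z * pd true u z + s z * u z by [].
  have wE : (u * u) z = u z * u z by [].
  have CE : cutoff2 (1 / 4) z = cutoff (1 / 4) z * cutoff (1 / 4) z by [].
  have sym : pd true (pd false u) z = pd false (pd true u) z by exact: (pdC oD _ _ su dz).
  have pdV a : pd a V z = (pd false u z * pd a (pd false u) z
      + pd false u z * pd a (pd false u) z + (pd true u z * pd a (pd true u) z
      + pd true u z * pd a (pd true u) z)) + (s z * pd a u z + u z * pd a s z).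
    rewrite /V (pdD a sN sV2 dz) (pdD a s00 s11 dz) (pdM a su0 su0 dz).
    by rewrite (pdM a su1 su1 dz) (pdM a ss su dz).
  have pdw a : pd a (u * u) z = u z * pd a u z + u z * pd a u z.
    by rewrite (pdM a su su dz).
  have lapw : lap (u * u) z = u z * lap u z + u z * lap u z
      + 2 * (pd false u z * pd false u z + pd true u z * pd true u z).
    by rewrite (lapM oD su su dz).
  (* Bochner's formula in the flat plane: as the Laplacian commutes with partial derivatives, third
     derivatives of [u] enter only through the gradient of [lap u]. *)
  have lapV : lap V z = (pd false u z * pd false (lap u) z + pd false u z * pd false (lap u) z
      + 2 * (pd false (pd false u) z * pd false (pd false u) z
        + pd false (pd true u) z * pd false (pd true u) z)
      + (pd true u z * pd true (lap u) z + pd true u z * pd true (lap u) z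
      + 2 * (pd false (pd true u) z * pd false (pd true u) z
        + pd true (pd true u) z * pd true (pd true u) z)))
      + (s z * lap u z + u z * lap s z
      + 2 * (pd false s z * pd false u z + pd true s z * pd true u z)).
    rewrite /V (lapD oD sN sV2 dz) (lapD oD s00 s11 dz) (lapM oD su0 su0 dz).
    by rewrite (lapM oD su1 su1 dz) (lapM oD ss su dz) !(lap_pd oD _ su dz) sym.
  move: H (lpd false) (lpd true) lE.
  rewrite wE VE CE !pdw lapw lap_cutoff2 !pd_cutoff2 !pdV lapV sym => H H0 H1 HE.
  have e0 : 0 < cutoff (1 / 4) z by rewrite cutoffE subr_gt0.
  have u1 : 0 < u z <= 1 by rewrite g1; exact: small_le1 K1 g1 g2.
  have sC : 0 <= s z <= C1 * u z by apply/andP; split; [exact: g3|exact: (ratio_bound (ltW zc))].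
  exact: (cheng_yau_jet K1 C10 erefl u1 sC (sqrtr_ge0 _) sqs g4 e0 (cutoffE _ _)
    (g6 false) (g6 true) g5 (lapE _ _) g7 (g8 false) (g8 true) HE H0 H1 H).
have z0 : sqn ((0, 0) : R * R) = 0 by rewrite /sqn /= !mul0r addr0.
have d0 : Disc (0, 0) by apply: (Disc_lt (lexx 1)); rewrite z0.
have [g1 _ g3 _ _ _ _ _] := gi d0.
have : sqn ((0, 0) : R * R) <= 1 / 4 by rewrite z0 ltW.
move=> /(lle (0, 0)).
rewrite [cutoff2 _ _](_ : _ = cutoff (1 / 4) (0, 0) * cutoff (1 / 4) (0, 0))//.
have ec : cutoff (1 / 4) ((0, 0) : R * R) = 1 / 4 by rewrite cutoffE z0 subr0.
move=> h; have [] := center_ineq_alg lB ec g1 g3 h.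
by rewrite /gradient_const /= -/C1 -/B; case: b.
Qed.

End Gradient.

(** * Discs in coordinates *)

Section FiniteSums.
Context {R : realType}.

Lemma ler_norm_sum_const (m : nat) (x : 'I_m -> R) (c : R) :
  (forall i, `|x i| <= c) -> `|\sum_i x i| <= m%:R * c.
Proof.
move=> xc; apply: le_trans (ler_norm_sum _ _ _) _.
apply: le_trans (ler_sum _ (fun i _ => xc i)) _.
by rewrite sumr_const card_ord mulr_natl.
Qed.

Lemma ler_term_sum (m : nat) (x : 'I_m -> R) i : (forall i, 0 <= x i) ->
  x i <= \sum_i x i.
Proof. by move=> x0; rewrite (bigD1 i)//= lerDl sumr_ge0. Qed.

Lemma sqr_le_normr_sqrt (a b : R) : a ^+ 2 <= b -> `|a| <= Num.sqrt b.
Proof. by move=> ab; rewrite -sqrtr_sqr ler_wsqrtr. Qed.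

Lemma sqr_alg (a b c C : R) : a ^+ 2 = c ->
  a * (C * (a * b + a * c)) = C * (c * b + c * c).
Proof. by move=> <-; ring. Qed.

Lemma double_le (x y : R) : x <= y + y -> 2 * x <= 4 * y.
Proof. lra. Qed.

Lemma half_le (k x y : R) : k * x <= k * y -> 2 * k * y <= 1 -> k * x <= 1 / 2.
Proof. lra. Qed.

Lemma lap_height_alg (x y : R) : - x <= y <= x -> - (3 * x) <= - (2 * x) - y <= - x.
Proof. by move=> /andP[h1 h2]; apply/andP; split; lra. Qed.

Lemma system_const_alg1 (M C : R) : 0 <= M -> 0 <= M * C ->
  M * 4 <= 1 + 8 * M + 4 * M * C + 4 * M ^+ 2 * C ^+ 2.
Proof.
move=> M0 MC; have : 0 <= M ^+ 2 * C ^+ 2 by apply: mulr_ge0; exact: sqr_ge0.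
lra.
Qed.

Lemma lap_energy_alg (M C x d S : R) : 0 <= M -> 0 <= M * C ->
  `|S| <= M * (4 * (C * (x * d + x * x))) ->
  d ^+ 2 - (1 + 8 * M + 4 * M * C + 4 * M ^+ 2 * C ^+ 2) * x ^+ 2 <= 2 * d ^+ 2 + S.
Proof.
move=> M0 MC; rewrite ler_norml => /andP[a1 _].
have h1 : 4 * (M * C) * (x * d) <= d ^+ 2 + 4 * M ^+ 2 * C ^+ 2 * x ^+ 2.
  by have := sqr_ge0 (d - 2 * (M * C) * x); lra.
have h2 : 0 <= x ^+ 2 by exact: sqr_ge0.
have h3 := mulr_ge0 M0 h2.
lra.
Qed.

Lemma pd_lap_height_alg1 (C e sd ss x : R) : 0 <= C -> e <= 1 -> 0 <= sd -> 0 <= ss ->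
  x <= e * (C * (sd + ss)) + C * ss -> x <= 2 * C * (sd + ss).
Proof.
move=> C0 e1 sd0 ss0 h.
have x1 := ler_piMl (mulr_ge0 C0 (addr_ge0 sd0 ss0)) e1.
have x2 := mulr_ge0 C0 sd0.
lra.
Qed.

Lemma pd_lap_height_alg2 (M C sd ss x y : R) : 0 <= M -> 0 <= M * C -> 0 <= sd ->
  0 <= ss -> x <= M * (4 * sd) -> y <= M * (2 * C * (sd + ss)) ->
  2 * x + 2 * y <= (1 + 8 * M + 4 * M * C + 4 * M ^+ 2 * C ^+ 2) * (sd + ss).
Proof.
move=> M0 MC sd0 ss0 h1 h2.
have x3 : 0 <= M ^+ 2 * C ^+ 2 * (sd + ss).
  by apply: mulr_ge0; [apply: mulr_ge0; exact: sqr_ge0|exact: addr_ge0].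
have x4 := mulr_ge0 M0 ss0; lra.
Qed.

End FiniteSums.

(** * Vector functions whose Laplacian is quadratic in the gradient *)

Section QuadraticSystem.
Context {R : realType}.
Local Notation Disc := (@unit_disc R).
Variables (m : nat) (g : 'I_m -> R * R -> R).

Definition energy : R * R -> R :=
  \sum_k (pd false (g k) * pd false (g k) + pd true (g k) * pd true (g k)).

Definition hess2 z : R := \sum_k
  (pd false (pd false (g k)) z ^+ 2 + pd true (pd false (g k)) z ^+ 2
   + (pd false (pd true (g k)) z ^+ 2 + pd true (pd true (g k)) z ^+ 2)).

Definition hess z : R := Num.sqrt (hess2 z).

Definition height (r : R) : R * R -> R := cst r - \sum_k g k * g k.

Hypothesis sg : forall k, smooth_on Disc (g k).
Let oD := @open_unit_disc R.

Let sp b k : smooth_on Disc (pd b (g k)).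
Proof. exact: smooth_pd. Qed.

Let sE k : smooth_on Disc (pd false (g k) * pd false (g k) + pd true (g k) * pd true (g k)).
Proof. by apply: smoothD oD _ _; apply: smoothM oD _ _; exact: sp. Qed.

Lemma smooth_energy : smooth_on Disc energy.
Proof. exact: smooth_sum oD sE. Qed.

Let sgg k : smooth_on Disc (g k * g k).
Proof. exact: smoothM. Qed.

Lemma smooth_height r : smooth_on Disc (height r).
Proof.
apply: smoothB oD _ _; first exact: smooth_cst.
exact: smooth_sum oD sgg.
Qed.

Lemma energyE z : energy z = \sum_k (pd false (g k) z ^+ 2 + pd true (g k) z ^+ 2).
Proof. by rewrite /energy fct_sumE; apply: eq_bigr => k _; rewrite !expr2. Qed.

Lemma heightE r z : height r z = r - \sum_k g k z ^+ 2.
Proof.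
rewrite [LHS](_ : _ = r - (\sum_k g k * g k) z)// fct_sumE.
by congr (_ - _); apply: eq_bigr => k _; rewrite expr2.
Qed.

Lemma energy_ge0 z : 0 <= energy z.
Proof. by rewrite energyE; apply: sumr_ge0 => k _; rewrite addr_ge0 ?sqr_ge0. Qed.

Lemma hess2_ge0 z : 0 <= hess2 z.
Proof. by apply: sumr_ge0 => k _; rewrite !addr_ge0 ?sqr_ge0. Qed.

Local Notation sig z := (Num.sqrt (energy z)).

Lemma sqr_sig z : sig z ^+ 2 = energy z.
Proof. by rewrite sqr_sqrtr// energy_ge0. Qed.

Lemma sqr_hess z : hess z ^+ 2 = hess2 z.
Proof. by rewrite sqr_sqrtr// hess2_ge0. Qed.

Lemma pd_le_sig b k z : `|pd b (g k) z| <= sig z.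
Proof.
apply: sqr_le_normr_sqrt; rewrite energyE.
apply: le_trans (ler_term_sum k _); last by move=> i; rewrite addr_ge0 ?sqr_ge0.
by case: b; [rewrite lerDr|rewrite lerDl]; exact: sqr_ge0.
Qed.

Lemma pd2_le_hess a b k z : `|pd a (pd b (g k)) z| <= hess z.
Proof.
apply: sqr_le_normr_sqrt.
apply: le_trans (ler_term_sum k _); last by move=> i; rewrite !addr_ge0 ?sqr_ge0.
set x := pd false (pd false _) z; set y := pd true (pd false _) z.
set v := pd false (pd true _) z; set w := pd true (pd true _) z.
have := sqr_ge0 x; have := sqr_ge0 y; have := sqr_ge0 v; have := sqr_ge0 w.
by case: a; case: b; rewrite -/x -/y -/v -/w; clear; lra.
Qed.

Lemma pd_energy b z : Disc z -> pd b energy z =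
  \sum_k 2 * (pd false (g k) z * pd b (pd false (g k)) z
    + pd true (g k) z * pd b (pd true (g k)) z).
Proof.
have alg (p a q c : R) : p * a + p * a + (q * c + q * c) = 2 * (p * a + q * c) by ring.
move=> dz; rewrite /energy (pd_sum b sE dz); apply: eq_bigr => k _.
rewrite (pdD b (smoothM oD (sp _ _) (sp _ _)) (smoothM oD (sp _ _) (sp _ _)) dz).
rewrite (pdM b (sp _ _) (sp _ _) dz) (pdM b (sp _ _) (sp _ _) dz).
exact: alg.
Qed.

Lemma lap_energy z : Disc z -> lap energy z = 2 * hess2 z +
  \sum_k 2 * (pd false (g k) z * pd false (lap (g k)) z
    + pd true (g k) z * pd true (lap (g k)) z).
Proof.
have alg (a b c d p q x y : R) : p * a + p * a + 2 * (x * x + y * y) +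
    (q * b + q * b + 2 * (c * c + d * d)) =
    2 * (x ^+ 2 + y ^+ 2 + (c ^+ 2 + d ^+ 2)) + 2 * (p * a + q * b) by ring.
move=> dz; rewrite /energy (lap_sum oD sE dz) /hess2 mulr_sumr -big_split.
apply: eq_bigr => k _; rewrite /=.
rewrite (lapD oD (smoothM oD (sp _ _) (sp _ _)) (smoothM oD (sp _ _) (sp _ _)) dz).
rewrite (lapM oD (sp _ _) (sp _ _) dz) (lapM oD (sp _ _) (sp _ _) dz).
rewrite !(lap_pd oD _ (sg k) dz); exact: alg.
Qed.

Lemma lap_height r z : Disc z -> lap (height r) z =
  - (2 * energy z) - \sum_k 2 * (g k z * lap (g k) z).
Proof.
have alg (a b p q : R) : p * a + p * a + 2 * (b * b + q * q) =
    2 * (b ^+ 2 + q ^+ 2) + 2 * (p * a) by ring.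
move=> dz; rewrite /height.
rewrite (lapB oD (@smooth_cst _ _ _ Disc r) (smooth_sum oD sgg) dz).
rewrite (lap_cst oD r dz) sub0r (lap_sum oD sgg dz) energyE -opprD; congr (- _).
rewrite mulr_sumr -big_split; apply: eq_bigr => k _ /=.
rewrite (lapM oD (sg k) (sg k) dz); exact: alg.
Qed.

Let slap k : smooth_on Disc (lap (g k)).
Proof. exact: smooth_lap. Qed.

Let sgl k : smooth_on Disc (g k * lap (g k)).
Proof. exact: smoothM. Qed.

Lemma pd_lap_height b r z : Disc z -> pd b (lap (height r)) z =
  - (2 * pd b energy z) - 2 * \sum_k (g k z * pd b (lap (g k)) z
      + lap (g k) z * pd b (g k) z).
Proof.
have c2 := @smooth_cst _ _ R Disc 2.
have sc := smoothM oD c2 smooth_energy.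
have sS := smoothM oD c2 (smooth_sum oD sgl).
have E y : Disc y -> lap (height r) y =
    (- (cst 2 * energy) - cst 2 * \sum_k g k * lap (g k)) y.
  move=> dy; rewrite (lap_height r dy).
  rewrite [RHS](_ : _ = - (2 * energy y) - 2 * (\sum_k g k * lap (g k)) y)//.
  by rewrite fct_sumE mulr_sumr.
move=> dz; apply: (etrans (eq_on_pd oD b dz E)).
apply: (etrans (pdB b (smoothN oD sc) sS dz)).
have -> : pd b (- (cst 2 * energy)) z = - (2 * pd b energy z).
  have := pdB b (@smooth_cst _ _ R Disc 0) sc dz.
  rewrite [cst 0 - _](_ : _ = - (cst 2 * energy)); last by rewrite -[RHS]sub0r.
  by move=> ->; rewrite pd_cst sub0r (pdZ b 2 smooth_energy dz).
rewrite (pdZ b 2 (smooth_sum oD sgl) dz) (pd_sum b sgl dz).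
congr (_ - 2 * _); apply: eq_bigr => k _.
exact: (pdM b (sg k) (slap k) dz).
Qed.

Variables (C1 e : R).
Hypothesis (C10 : 0 <= C1).
Hypothesis lap_le : forall k z, Disc z -> `|lap (g k) z| <= C1 * energy z.
Hypothesis pd_lap_le : forall b k z, Disc z ->
  `|pd b (lap (g k)) z| <= C1 * (sig z * hess z + sig z * energy z).
Hypothesis e01 : 0 <= e <= 1.
Hypothesis g_lt : forall z, Disc z -> \sum_k g k z ^+ 2 < e ^+ 2.

(** One constant for all the inequalities: [8 * m%:R] and [4 * m%:R * C1] bound the gradient of
    [lap u] (and the first also that of the energy), while [4 * m%:R ^+ 2 * C1 ^+ 2] comes from
    completing the square in the Laplacian of the energy. *)
Definition system_const : R :=
  1 + 8 * m%:R + 4 * m%:R * C1 + 4 * m%:R ^+ 2 * C1 ^+ 2.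

Hypothesis e_small : 2 * m%:R * C1 * e <= 1.
Hypothesis e_small2 : 2 * system_const * e ^+ 2 <= 1.

Let m0 : 0 <= m%:R :> R. Proof. exact: ler0n. Qed.

Lemma system_const_ge1 : 1 <= system_const.
Proof.
rewrite /system_const -!addrA lerDl !addr_ge0// ?mulr_ge0//.
Qed.

(** Both smallness conditions enter here. By [e_small] the term [2 g . Lap g] of [Lap u] is at most
    the energy [s], so that [Lap u = - 2 s - 2 g . Lap g] lies between [- 3 s] and [- s]; by
    [e_small2] the height satisfies [K u <= 1 / 2]. The rest is the product rule with the bounds on
    [lap (g k)] and its gradient. *)
Lemma system_gradient_ineqs z : Disc z ->
  gradient_ineqs system_const (height (e ^+ 2)) energy hess z.
Proof.
move=> dz; have /andP[e0 e1] := e01.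
have s0 := energy_ge0 z; have sg0 : 0 <= sig z by exact: sqrtr_ge0.
have d0 : 0 <= hess z by exact: sqrtr_ge0.
have sd0 : 0 <= sig z * hess z by exact: mulr_ge0.
have ss0 : 0 <= sig z * energy z by exact: mulr_ge0.
have g_le k : `|g k z| <= e.
  have := @sqr_le_normr_sqrt R (g k z) (e ^+ 2).
  rewrite sqrtr_sqr (ger0_norm e0); apply; apply: le_trans (ltW (g_lt dz)).
  by apply: (ler_term_sum k) => i; exact: sqr_ge0.
have mC0 : 0 <= m%:R * C1 by exact: mulr_ge0.
have K1 := system_const_ge1.
have bs b : `|pd b energy z| <= m%:R * (4 * (sig z * hess z)).
  rewrite pd_energy//; apply: ler_norm_sum_const => k.
  have a1 := normr_mul_le (pd_le_sig false k z) (pd2_le_hess b false k z).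
  have a2 := normr_mul_le (pd_le_sig true k z) (pd2_le_hess b true k z).
  rewrite normrM ger0_norm//.
  exact: double_le (le_trans (ler_normD _ _) (lerD a1 a2)).
have hsg : `|\sum_k 2 * (g k z * lap (g k) z)| <= energy z.
  apply: (@le_trans _ _ (m%:R * (2 * (e * (C1 * energy z))))).
    apply: ler_norm_sum_const => k; rewrite normrM ger0_norm//.
    by apply: ler_wpM2l => //; exact: normr_mul_le (g_le k) (lap_le k dz).
  have -> : m%:R * (2 * (e * (C1 * energy z))) = 2 * m%:R * C1 * e * energy z by ring.
  by rewrite ler_piMl.
split.
- rewrite heightE subr_gt0; exact: g_lt.
- have h : height (e ^+ 2) z <= e ^+ 2.
    by rewrite heightE gerBl; apply: sumr_ge0 => k _; exact: sqr_ge0.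
  exact: half_le (ler_wpM2l (le_trans ler01 K1) h) e_small2.
- exact: s0.
- exact: d0.
- by rewrite (lap_height _ dz); apply: lap_height_alg; rewrite -ler_norml.
- move=> b; apply: le_trans (bs b) _.
  by rewrite mulrA; apply: ler_wpM2r => //; exact: system_const_alg1.
- rewrite (lap_energy dz) sqr_hess -sqr_hess; apply: lap_energy_alg => //.
  apply: ler_norm_sum_const => k.
  have a1 := normr_mul_le (pd_le_sig false k z) (pd_lap_le false k dz).
  have a2 := normr_mul_le (pd_le_sig true k z) (pd_lap_le true k dz).
  have E : sig z * (C1 * (sig z * hess z + sig z * energy z)) =
      C1 * (energy z * hess z + energy z * energy z).
    exact: sqr_alg (sqr_sig z).
  rewrite E in a1; rewrite E in a2; rewrite normrM ger0_norm//.
  exact: double_le (le_trans (ler_normD _ _) (lerD a1 a2)).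
- move=> b; rewrite (pd_lap_height b _ dz); set S := \sum_k _.
  have h : `|S| <= m%:R * (2 * C1 * (sig z * hess z + sig z * energy z)).
    apply: ler_norm_sum_const => k.
    have a1 := normr_mul_le (g_le k) (pd_lap_le b k dz).
    have a2 := normr_mul_le (lap_le k dz) (pd_le_sig b k z).
    rewrite -mulrA (mulrC _ (sig z)) in a2.
    exact: pd_lap_height_alg1 (le_trans (ler_normD _ _) (lerD a1 a2)).
  rewrite (le_trans (ler_normB _ _))// normrN !normrM ger0_norm//.
  exact: pd_lap_height_alg2 (bs b) h.
Qed.

End QuadraticSystem.

Lemma lap_system_alg {R : realType} (M C E : R) : 0 <= M -> 0 <= C -> 0 <= E ->
  M * (M * (C * (2 * E))) <= (4 * M ^+ 2 * C + 2 * M ^+ 3 * C) * E.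
Proof.
move=> M0 C0 E0; have h1 := mulr_ge0 (mulr_ge0 (exprn_ge0 2 M0) C0) E0.
have h2 := mulr_ge0 (mulr_ge0 (exprn_ge0 3 M0) C0) E0; lra.
Qed.

Lemma pd_lap_system_alg {R : realType} (M C sd ss : R) :
  0 <= M -> 0 <= C -> 0 <= sd -> 0 <= ss ->
  M * (M * (C * (4 * sd) + M * C * (2 * ss))) <=
  (4 * M ^+ 2 * C + 2 * M ^+ 3 * C) * (sd + ss).
Proof.
move=> M0 C0 sd0 ss0; have h1 := mulr_ge0 (mulr_ge0 (exprn_ge0 2 M0) C0) ss0.
have h2 := mulr_ge0 (mulr_ge0 (exprn_ge0 3 M0) C0) sd0; lra.
Qed.

(** * The Laplacian of a solution of the Cauchy-Riemann system *)

Section CauchyRiemannSystem.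
Context {R : realType}.
Local Notation Disc := (@unit_disc R).
Variables (m : nat) (g : 'I_m -> R * R -> R) (a : 'I_m -> 'I_m -> R * R -> R).
Variables (da : 'I_m -> 'I_m -> 'I_m -> R * R -> R).
Variables (dda : 'I_m -> 'I_m -> 'I_m -> 'I_m -> R * R -> R) (C0 : R).
Hypotheses (sg : forall k, smooth_on Disc (g k))
  (sa : forall k l, smooth_on Disc (a k l))
  (sda : forall k l i, smooth_on Disc (da k l i)).
Hypothesis pd_a : forall b k l z, Disc z ->
  pd b (a k l) z = \sum_i da k l i z * pd b (g i) z.
Hypothesis pd_da : forall b k l i z, Disc z ->
  pd b (da k l i) z = \sum_j dda k l i j z * pd b (g j) z.
Hypotheses (C00 : 0 <= C0)
  (da_le : forall k l i z, Disc z -> `|da k l i z| <= C0)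
  (dda_le : forall k l i j z, Disc z -> `|dda k l i j z| <= C0).
Hypothesis cr_true : forall k z, Disc z ->
  pd true (g k) z = \sum_l a k l z * pd false (g l) z.
Hypothesis cr_false : forall k z, Disc z ->
  pd false (g k) z = - \sum_l a k l z * pd true (g l) z.

Let oD := @open_unit_disc R.

Let sp b k : smooth_on Disc (pd b (g k)).
Proof. exact: smooth_pd. Qed.

(** Minus the Jacobian determinant of [(g i, g l)] with respect to the two plane coordinates. *)
Definition jac i l : R * R -> R :=
  pd true (g i) * pd false (g l) - pd false (g i) * pd true (g l).

Let sap b k l : smooth_on Disc (a k l * pd b (g l)).
Proof. by apply: smoothM. Qed.

Let pd_sum_cr b c k z : Disc z -> pd b (\sum_l a k l * pd c (g l)) z =
  \sum_l (a k l z * pd b (pd c (g l)) z + pd c (g l) z * pd b (a k l) z).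
Proof.
move=> dz; rewrite (pd_sum b (fun l => sap c k l) dz); apply: eq_bigr => l _.
exact: (pdM b (sa k l) (sp c l) dz).
Qed.

(** Each equation is differentiated once. The second derivatives occur as [a k l] times the
    difference of the two mixed derivatives of [g l] and cancel by symmetry; only derivatives of [a]
    times first derivatives of [g] survive. *)
Lemma lap_system k z : Disc z ->
  lap (g k) z = \sum_l \sum_i da k l i z * jac i l z.
Proof.
move=> dz; rewrite lapE.
have -> : pd true (pd true (g k)) z = pd true (\sum_l a k l * pd false (g l)) z.
  by apply: (eq_on_pd oD true dz) => y dy; rewrite cr_true// fct_sumE.
have sS c : smooth_on Disc (\sum_l a k l * pd c (g l)).
  by apply: (smooth_sum oD) => l; exact: sap.
have -> : pd false (pd false (g k)) z = - pd false (\sum_l a k l * pd true (g l)) z.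
  have := pdB false (@smooth_cst _ _ R Disc 0) (sS true) dz.
  rewrite pd_cst => E0; rewrite -[RHS]sub0r -E0; apply: (eq_on_pd oD false dz) => y dy.
  rewrite cr_false// [RHS](_ : _ = 0 - (\sum_l a k l * pd true (g l)) y)//.
  by rewrite fct_sumE sub0r.
rewrite !pd_sum_cr// -sumrN -big_split; apply: eq_bigr => l _ /=.
rewrite (pdC oD _ _ (sg l) dz) !pd_a//.
have -> : \sum_i da k l i z * jac i l z =
    pd false (g l) z * (\sum_i da k l i z * pd true (g i) z) -
    pd true (g l) z * (\sum_i da k l i z * pd false (g i) z).
  rewrite !mulr_sumr -sumrB; apply: eq_bigr => i _.
  rewrite [jac i l z](_ : _ = pd true (g i) z * pd false (g l) z -
    pd false (g i) z * pd true (g l) z)//.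
  by move: (da k l i z) (pd _ _ _) (pd _ _ _) (pd _ _ _) (pd _ _ _) => p x y v w; ring.
move: (a k l z) (pd true (pd false _) z) => p q.
by move: (pd _ _ _ * _) (pd _ _ _ * _) => x y; ring.
Qed.

Local Notation sig z := (Num.sqrt (energy g z)).

Lemma jac_le i l z : `|jac i l z| <= 2 * energy g z.
Proof.
rewrite [jac i l z](_ : _ = pd true (g i) z * pd false (g l) z -
    pd false (g i) z * pd true (g l) z)//.
have h1 := normr_mul_le (pd_le_sig g true i z) (pd_le_sig g false l z).
have h2 := normr_mul_le (pd_le_sig g false i z) (pd_le_sig g true l z).
apply: le_trans (ler_normB _ _) (le_trans (lerD h1 h2) _).
by rewrite -expr2 sqr_sig mulr_natl mulr2n.
Qed.

Let sjac i l : smooth_on Disc (jac i l).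
Proof. by apply: (smoothB oD); apply: (smoothM oD); exact: sp. Qed.

Lemma pd_jac_le b i l z : Disc z -> `|pd b (jac i l) z| <= 4 * (sig z * hess g z).
Proof.
move=> dz; rewrite (pdB b (smoothM oD (sp true i) (sp false l))
  (smoothM oD (sp false i) (sp true l)) dz).
rewrite (pdM b (sp true i) (sp false l) dz) (pdM b (sp false i) (sp true l) dz).
have h c d p q : `|pd c (g p) z * pd b (pd d (g q)) z| <= sig z * hess g z.
  by apply: normr_mul_le; [exact: pd_le_sig|exact: pd2_le_hess].
apply: le_trans (ler_normB _ _) _.
apply: le_trans (lerD (ler_normD _ _) (ler_normD _ _)) _.
apply: le_trans (lerD (lerD (h _ _ _ _) (h _ _ _ _)) (lerD (h _ _ _ _) (h _ _ _ _))) _.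
by rewrite -!mulr2n -mulrnA mulr_natl.
Qed.

(** There are [m ^ 2] terms [da * jac]. Differentiating [jac] costs the factor [4] of [pd_jac_le];
    differentiating [da] brings one more sum of length [m], with the factor [2] of [jac_le]. *)
Definition lap_const : R := 4 * m%:R ^+ 2 * C0 + 2 * m%:R ^+ 3 * C0.

Lemma lap_const_ge0 : 0 <= lap_const.
Proof.
have m0 : 0 <= m%:R :> R by exact: ler0n.
by rewrite addr_ge0//; apply: mulr_ge0 => //; apply: mulr_ge0 => //; exact: exprn_ge0.
Qed.

Lemma lap_system_le k z : Disc z -> `|lap (g k) z| <= lap_const * energy g z.
Proof.
move=> dz; rewrite lap_system//.
apply: le_trans (lap_system_alg (ler0n _ _) C00 (energy_ge0 g z)).
apply: ler_norm_sum_const => l; apply: ler_norm_sum_const => i.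
by apply: normr_mul_le; [exact: da_le|exact: jac_le].
Qed.

(** [lap_system] expresses the Laplacian by first derivatives of [g], so its gradient involves no
    third derivative: it contains either one second derivative, through [jac], or one more first
    derivative, through the chain rule for [da]. *)
Lemma pd_lap_system_le b k z : Disc z ->
  `|pd b (lap (g k)) z| <= lap_const * (sig z * hess g z + sig z * energy g z).
Proof.
have sdj l i : smooth_on Disc (da k l i * jac i l) by apply: smoothM.
have sdj' l : smooth_on Disc (\sum_i da k l i * jac i l) by apply: smooth_sum.
move=> dz.
have -> : pd b (lap (g k)) z = pd b (\sum_l \sum_i da k l i * jac i l) z.
  apply: (eq_on_pd oD b dz) => y dy; rewrite lap_system// fct_sumE.
  by apply: eq_bigr => l _; rewrite fct_sumE.
rewrite (pd_sum b sdj' dz).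
have s0 : 0 <= sig z by exact: sqrtr_ge0.
apply: le_trans (pd_lap_system_alg (ler0n _ _) C00 (mulr_ge0 s0 (sqrtr_ge0 _))
  (mulr_ge0 s0 (energy_ge0 g z))).
apply: ler_norm_sum_const => l; rewrite (pd_sum b (sdj l) dz).
apply: ler_norm_sum_const => i; rewrite (pdM b (sda k l i) (sjac i l) dz).
apply: le_trans (ler_normD _ _) _; apply: lerD.
  by apply: normr_mul_le; [exact: da_le|exact: pd_jac_le].
have h : `|pd b (da k l i) z| <= m%:R * (C0 * sig z).
  rewrite pd_da//; apply: ler_norm_sum_const => j.
  by apply: normr_mul_le; [exact: dda_le|exact: pd_le_sig].
have := normr_mul_le (jac_le i l z) h.
have -> // : 2 * energy g z * (m%:R * (C0 * sig z)) = m%:R * C0 * (2 * (sig z * energy g z)).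
by move: (sig z) (energy g z) => x y; ring.
Qed.

End CauchyRiemannSystem.

(** * The estimate for discs in a small Euclidean ball *)

Section DiscEstimate.
Context {R : realType} {m : nat}.
Local Notation Disc := (@unit_disc R).
Implicit Types w : 'cV[R]_m.

Definition sqdist (z0 : 'cV[R]_m) w : R := \sum_k (w k 0 - z0 k 0) ^+ 2.

Lemma near_bounded_family (I : finType) (f : I -> 'cV[R]_m -> R) (z0 : 'cV[R]_m) :
  (forall i, {for z0, continuous (f i)}) ->
  exists2 C : R, 0 <= C & \forall w \near z0, forall i, `|f i w| <= C.
Proof.
move=> cf; exists (1 + \sum_i `|f i z0|).
  by rewrite addr_ge0//; apply: sumr_ge0.
pose P i w : Prop := `|f i w| <= 1 + \sum_i `|f i z0|.
suff : \forall w \near z0, forall i, P i w by [].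
apply: (@filter_forall _ _ P (nbhs z0)) => i; rewrite {}/P.
have /cvgrPdist_lt /(_ 1 ltr01) := cf i.
apply: filterS => w /= h.
have h1 : `|f i w| <= `|f i z0| + 1.
  rewrite -(subrK (f i z0) (f i w)) addrC.
  by rewrite (le_trans (ler_normD _ _))// lerD2l distrC ltW.
apply: le_trans h1 _; rewrite addrC lerD2l.
by rewrite (bigD1 i)//= lerDl sumr_ge0.
Qed.

(** The norm of column vectors is the maximum norm, and the square of each entry of [w - z0] is at
    most [sqdist z0 w]. *)
Lemma near_sqdist (z0 : 'cV[R]_m) (P : set 'cV[R]_m) : nbhs z0 P ->
  exists2 e : R, 0 < e & forall w, sqdist z0 w < e ^+ 2 -> P w.
Proof.
move=> /nbhs_ballP[e /= e0 eP]; exists e => // w we; apply: eP.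
rewrite -ball_normE /ball_ /=; rewrite [X in X < _]/Num.Def.normr /= mx_normrE.
apply/bigmax_ltP; split=> // -[i j] _ /=; rewrite ord1 !mxE.
rewrite -ltr_sqr ?nnegrE ?(ltW e0)// real_normK ?num_real//.
apply: le_lt_trans we; rewrite -sqrrN opprB /sqdist.
by apply: (@ler_term_sum _ _ (fun k => (w k 0 - z0 k 0) ^+ 2)) => k; exact: sqr_ge0.
Qed.

(** The order of the quantifiers matters: [C] is chosen before the disc [F], as a lower bound for an
    infimum over discs requires. The absolute value on the left is that of the [x]-derivative of [u]
    at the centre. *)
Theorem disc_estimate (O : set 'cV[R]_m) (A : 'cV[R]_m -> 'M[R]_m) (z0 : 'cV[R]_m) :
  open O -> smooth_on O A -> O z0 ->
  exists2 r : R, 0 < r & forall e : R, 0 < e <= r ->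
    (forall w, sqdist z0 w < e ^+ 2 -> O w) /\
    exists2 C : R, 0 < C & forall F : R * R -> 'cV[R]_m,
      smooth_on Disc F ->
      (forall z, Disc z -> sqdist z0 (F z) < e ^+ 2) ->
      (forall z, Disc z ->
        'D_(plane_dir true) F z = A (F z) *m 'D_(plane_dir false) F z) ->
      (forall z, Disc z ->
        'D_(plane_dir false) F z = - (A (F z) *m 'D_(plane_dir true) F z)) ->
      `|\sum_k 2 * ((F (0, 0) k 0 - z0 k 0) * ('D_(plane_dir false) F (0, 0)) k 0)|
        <= C * (e ^+ 2 - sqdist z0 (F (0, 0))).
Proof.
move=> oO sA Oz0.
pose a k l w := A w k l.
have sa k l : smooth_on O (a k l) by exact: smooth_entry.
pose da k l i := 'D_(basis_vec i) (a k l).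
have sda k l i : smooth_on O (da k l i) by exact: smooth_derive.
pose dda k l i j := 'D_(basis_vec j) (da k l i).
have sdda k l i j : smooth_on O (dda k l i j) by exact: smooth_derive.
have [Ca Ca0 Cale] := @near_bounded_family ('I_m * 'I_m * 'I_m)%type
  (fun p => da p.1.1 p.1.2 p.2) z0 (fun p => smooth_continuous (sda _ _ _) Oz0).
have [Cb Cb0 Cble] := @near_bounded_family ('I_m * 'I_m * 'I_m * 'I_m)%type
  (fun p => dda p.1.1.1 p.1.1.2 p.1.2 p.2) z0 (fun p => smooth_continuous (sdda _ _ _ _) Oz0).
pose C0 := Ca + Cb.
have C00 : 0 <= C0 by exact: addr_ge0.
have [r0 r00 r0P] : exists2 e : R, 0 < e & forall w, sqdist z0 w < e ^+ 2 ->
    [/\ O w, forall k l i, `|da k l i w| <= C0 & forall k l i j, `|dda k l i j w| <= C0].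
  apply: near_sqdist; have nO : nbhs z0 O by exact: open_nbhs_nbhs.
  apply: filterS3 nO Cale Cble => w Ow h1 h2; split=> // [k l i|k l i j].
    by apply: le_trans (h1 (k, l, i)) _; rewrite lerDl.
  by apply: le_trans (h2 (k, l, i, j)) _; rewrite lerDr.
pose C1 := @lap_const R m C0.
have C10 : 0 <= C1 by exact: lap_const_ge0.
pose K := @system_const R m C1.
have K1 : 1 <= K by exact: system_const_ge1.
have K0 : 0 <= K by exact: le_trans K1.
(* With this [M], the single condition [M * e <= 1] gives [e <= 1] and both smallness conditions of
   [system_gradient_ineqs]. *)
pose M := 1 + 2 * m%:R * C1 + 2 * K.
have mC : 0 <= 2 * m%:R * C1 by rewrite !mulr_ge0.
have M1 : 1 <= M by rewrite /M -addrA lerDl addr_ge0// mulr_ge0.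
have M0 : 0 < M by exact: lt_le_trans M1.
exists (Num.min r0 M^-1); first by rewrite lt_min r00 invr_gt0.
move=> e /andP[e0]; rewrite le_min => /andP[er0 eM].
have eM1 : M * e <= 1 by rewrite mulrC -ler_pdivlMr// mul1r.
have e1 : e <= 1 by apply: le_trans eM1; rewrite ler_peMl// ltW.
have small1 : 2 * m%:R * C1 * e <= 1.
  apply: le_trans eM1; apply: ler_wpM2r; first exact: ltW.
  by rewrite /M addrAC lerDr addr_ge0// mulr_ge0.
have small2 : 2 * K * e ^+ 2 <= 1.
  apply: le_trans eM1; rewrite expr2 mulrA.
  have h : 2 * K * e <= M * e.
    by apply: ler_wpM2r; [exact: ltW|rewrite /M lerDr addr_ge0].
  by apply: le_trans h; rewrite ler_piMr// !mulr_ge0// ltW.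
have e01 : 0 <= e <= 1 by rewrite ltW.
have BO w : sqdist z0 w < e ^+ 2 ->
    [/\ O w, forall k l i, `|da k l i w| <= C0 & forall k l i j, `|dda k l i j w| <= C0].
  move=> we; apply: r0P; apply: lt_le_trans we _.
  by rewrite lerXn2r// nnegrE ltW.
split=> [w /BO[]//|].
(* [gradient_bound] compares squares; since [c <= (c + 1) ^+ 2], the constant [c + 1] serves without
   a square root. *)
exists (gradient_const K + 1) => [|F sF Fe crt crf].
  by rewrite addr_gt0// gradient_const_gt0.
have oD := @open_unit_disc R.
pose g k : R * R -> R := coordf F k - cst (z0 k 0).
have sc k : smooth_on Disc (coordf F k) by exact: smooth_coordf.
have sg k : smooth_on Disc (g k).
  by apply: (smoothB oD (sc k)); exact: smooth_cst.
have pdg b k z : Disc z -> pd b (g k) z = ('D_(plane_dir b) F z) k 0.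
  move=> dz; apply: (etrans (pdB b (sc k) (@smooth_cst _ _ _ Disc (z0 k 0)) dz)).
  rewrite pd_cst subr0 pdE derive_coordf//; exact: smooth_derivable dz.
have FO z : Disc z -> O (F z) by move=> /Fe /BO [].
pose at_ k l : R * R -> R := a k l \o F.
pose dat k l i : R * R -> R := da k l i \o F.
pose ddat k l i j : R * R -> R := dda k l i j \o F.
have sat k l : smooth_on Disc (at_ k l) by exact: smooth_comp_coord FO sF (sa k l).
have sdat k l i : smooth_on Disc (dat k l i) by exact: smooth_comp_coord FO sF (sda k l i).
have chain (h : 'cV[R]_m -> R) b z : smooth_on O h -> Disc z ->
    pd b (h \o F) z = \sum_i 'D_(basis_vec i) h (F z) * pd b (g i) z.
  move=> sh dz; rewrite pdE derive_comp_coord.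
  - apply: eq_bigr => i _; rewrite pdg// derive_coordf//.
    exact: smooth_derivable dz.
  - exact: smooth_differentiable dz.
  - exact: smooth_differentiable (FO _ dz).
have pda b k l z : Disc z -> pd b (at_ k l) z = \sum_i dat k l i z * pd b (g i) z.
  by move=> dz; exact: chain (sa k l) dz.
have pdda b k l i z : Disc z ->
    pd b (dat k l i) z = \sum_j ddat k l i j z * pd b (g j) z.
  by move=> dz; exact: chain (sda k l i) dz.
have dle k l i z : Disc z -> `|dat k l i z| <= C0.
  by move=> /Fe /BO [_ h _]; exact: h.
have ddle k l i j z : Disc z -> `|ddat k l i j z| <= C0.
  by move=> /Fe /BO [_ _ h]; exact: h.
have cr1 k z : Disc z -> pd true (g k) z = \sum_l at_ k l z * pd false (g l) z.
  move=> dz; rewrite pdg// crt// mxE; apply: eq_bigr => l _.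
  by rewrite pdg.
have cr2 k z : Disc z -> pd false (g k) z = - \sum_l at_ k l z * pd true (g l) z.
  move=> dz; rewrite pdg// crf// !mxE; congr (- _); apply: eq_bigr => l _.
  by rewrite pdg.
have ll k z := @lap_system_le R m g at_ dat C0 sg sat pda C00 dle cr1 cr2 k z.
have pll b k z := @pd_lap_system_le R m g at_ dat ddat C0 sg sat sdat pda pdda C00
  dle ddle cr1 cr2 b k z.
have glt z : Disc z -> \sum_k g k z ^+ 2 < e ^+ 2 by exact: Fe.
have gi z := @system_gradient_ineqs R m g sg C1 e C10 ll pll e01 glt small1 small2 z.
have d0 : Disc (0, 0) by rewrite unit_discE /= /sqn /= !mul0r addr0.
have := gradient_bound K1 (smooth_height sg (e ^+ 2)) (smooth_energy sg) gi false.
have hE : height g (e ^+ 2) (0, 0) = e ^+ 2 - sqdist z0 (F (0, 0)) by exact: heightE.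
rewrite hE.
have -> : pd false (height g (e ^+ 2)) (0, 0) =
    - \sum_k 2 * ((F (0, 0) k 0 - z0 k 0) * ('D_(plane_dir false) F (0, 0)) k 0).
  have sgg k : smooth_on Disc (g k * g k) by exact: smoothM.
  apply: (etrans (pdB false (@smooth_cst _ _ R Disc (e ^+ 2)) (smooth_sum oD sgg) d0)).
  rewrite pd_cst sub0r (pd_sum false sgg d0); congr (- _); apply: eq_bigr => k _.
  rewrite (pdM false (sg k) (sg k) d0) pdg// -mulr2n mulr_natl.
  by congr (_ *+ _).
have u0 : 0 < e ^+ 2 - sqdist z0 (F (0, 0)) by rewrite subr_gt0; exact: Fe.
rewrite sqrrN -[_ ^+ 2 in X in X <= _ -> _](real_normK (num_real _)); set X := `|_|; move: (e ^+ 2 - _) u0 => U U0 h.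
have X0 : 0 <= X by exact: normr_ge0.
have c0 : 0 < gradient_const K by exact: gradient_const_gt0.
move: (gradient_const K) c0 h => c c0 h.
rewrite -ler_sqr ?nnegrE//; last by rewrite mulr_ge0 ?addr_ge0// ltW.
apply: le_trans h _; rewrite exprMn; apply: ler_wpM2r; first exact: sqr_ge0.
by clear - c0; nra.
Qed.

End DiscEstimate.

(** * The Kobayashi pseudodistance of a chart ball *)

Section SqdistTopology.
Context {R : realType} {m : nat} (z0 : 'cV[R]_m).

Definition dsqdist (w v : 'cV[R]_m) : R := \sum_k 2 * ((w k 0 - z0 k 0) * v k 0).

Section Compose.
Context {V : normedModType R} (D : set V) (F : V -> 'cV[R]_m).
Hypotheses (oD : open D) (sF : smooth_on D F).

Let g k : V -> R := coordf F k - cst (z0 k 0).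

Let sg k : smooth_on D (g k).
Proof. by apply: (smoothB oD); [exact: smooth_coordf|exact: smooth_cst]. Qed.

Let sgg k : smooth_on D (g k * g k).
Proof. exact: smoothM. Qed.

Let sqdist_comp : (fun x => sqdist z0 (F x)) = \sum_k g k * g k.
Proof. by apply/funext => x; rewrite fct_sumE; apply: eq_bigr => k _; rewrite expr2. Qed.

Lemma smooth_sqdist_comp : smooth_on D (fun x => sqdist z0 (F x)).
Proof. by rewrite sqdist_comp; exact: smooth_sum. Qed.

Lemma derive_sqdist_comp x v : D x ->
  'D_v (fun x => sqdist z0 (F x)) x = dsqdist (F x) ('D_v F x).
Proof.
move=> Dx; rewrite sqdist_comp derive_sum; last first.
  by move=> k; exact: smooth_derivable (sgg k) Dx.
apply: eq_bigr => k _.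
have dg : derivable (g k) x v by exact: smooth_derivable (sg k) Dx.
have dF : derivable F x v by exact: smooth_derivable sF Dx.
have dc : derivable (coordf F k) x v.
  by apply: smooth_derivable Dx; exact: smooth_coordf.
rewrite (deriveM dg dg).
have -> : 'D_v (g k) x = ('D_v F x) k 0.
  rewrite (deriveB dc (derivable_cst _ _ _)) derive_cst subr0.
  exact: derive_coordf.
by rewrite -mulr2n mulr_natl.
Qed.

End Compose.

Lemma continuous_sqdist : continuous (sqdist z0).
Proof.
move=> w; have sid : smooth_on setT (@id 'cV[R]_m).
  move=> [|k]; first by move=> x _; exact: cvg_id.
  split=> [x _|v]; first by apply: ex_diff.
  by rewrite (_ : (fun x => _) = cst v); [exact: Ck_cst|apply/funext => x; rewrite derive_id].
exact: (smooth_continuous (smooth_sqdist_comp openT sid)).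
Qed.

Lemma open_sqdist_lt (r : R) : open [set w | sqdist z0 w < r].
Proof.
rewrite (_ : [set w | _] = sqdist z0 @^-1` [set x | x < r])//.
by apply: open_comp => [w _|]; [exact: continuous_sqdist|exact: open_lt].
Qed.

End SqdistTopology.

(** * Lower bound for the Kobayashi-Royden metric of a chart ball *)

Section ChartBall.
Context {R : realType} (M : almostComplexManifold R).
Local Notation m := (2 * complex_dim M)%N.
Variables (i : chart_index M) (D0 : set M) (z0 : 'cV[R]_m) (e : R).
Hypotheses (oD0 : open D0) (D0i : D0 `<=` chart_dom i).

(** The intersection with [D0] is essential: [chart_map i] is a total function whose values outside
    the chart domain carry no meaning. *)
Definition chart_ball : set M :=
  D0 `&` [set q | sqdist z0 (chart_map i q) < e ^+ 2].

Lemma open_chart_ball : open chart_ball.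
Proof.
rewrite openE => q [Dq qe]; apply: filterI; first exact: open_nbhs_nbhs.
have ci : {for q, continuous (chart_map i)} by apply: chart_continuous; exact: D0i.
have h : nbhs (chart_map i q) [set w | sqdist z0 w < e ^+ 2].
  by apply: open_nbhs_nbhs; split => //; exact: open_sqdist_lt.
exact: (ci _ h).
Qed.

Local Notation N := (open_submanifold open_chart_ball).
Local Notation phi q := (chart_map i (set_val q : M)).

Lemma ball_dom (q : N) : chart_dom i (set_val q : M).
Proof. by apply: D0i; have [] := set_valP q. Qed.

Definition ball_height (q : N) : R := e ^+ 2 - sqdist z0 (phi q).

Lemma ball_height_gt0 q : 0 < ball_height q.
Proof. by rewrite subr_gt0; have [] := set_valP q. Qed.

Variable A : 'cV[R]_m -> 'M[R]_m.
Hypothesis JA : forall (p : M) v, D0 p -> tangent_space p v ->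
  acJ p v i = A (chart_map i p) *m v i.
Variable C : R.
Hypothesis C0 : 0 < C.
Hypothesis disc_le : forall F : R * R -> 'cV[R]_m,
  smooth_on (@unit_disc R) F ->
  (forall z, unit_disc z -> sqdist z0 (F z) < e ^+ 2) ->
  (forall z, unit_disc z ->
     'D_(plane_dir true) F z = A (F z) *m 'D_(plane_dir false) F z) ->
  (forall z, unit_disc z ->
     'D_(plane_dir false) F z = - (A (F z) *m 'D_(plane_dir true) F z)) ->
  `|\sum_k 2 * ((F (0, 0) k 0 - z0 k 0) * ('D_(plane_dir false) F (0, 0)) k 0)|
     <= C * (e ^+ 2 - sqdist z0 (F (0, 0))).

Lemma smooth_map_chart (V : normedModType R) (D : set V) (f : V -> N) :
  smooth_map D f -> smooth_on D (fun x => phi (f x)).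
Proof.
move=> [_ /(_ i)].
rewrite (_ : D `&` _ = D)//; apply/seteqP; split=> [x []//|x Dx].
by split=> //; exact: ball_dom.
Qed.

Lemma differential_chart (V : normedModType R) (f : V -> N) x w :
  differential f x w i = diff_at (fun y => phi (f y)) x w.
Proof. by rewrite /differential asboolT//; exact: ball_dom. Qed.

(** For a competing disc with [x]-derivative [v / a] at the centre, the disc estimate reads
    [|du(v)| / a <= C u(q)], which bounds [a] from below; the bound passes to the infimum. *)
Lemma kobayashi_royden_ge (q : N) v :
  ((`|dsqdist z0 (phi q) (v i)| / (C * ball_height q))%:E <= kobayashi_royden q v)%E.
Proof.
apply: le_ereal_inf_tmp => _ [a [a0 [f [[sf Jf] f0 df0]]] <-]; rewrite lee_fin.
have u0 := ball_height_gt0 q.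
rewrite ler_pdivrMr; last exact: mulr_gt0.
pose F z := phi (f z).
have sF : smooth_on (@unit_disc R) F by exact: smooth_map_chart.
have oD := @open_unit_disc R.
have dF z w : unit_disc z -> diff_at F z w = 'D_w F z.
  by move=> dz; rewrite /diff_at deriveE//; exact: smooth_differentiable sF dz.
(* Holomorphy in the chart. Taking [w] to be the two coordinate directions gives the two
   Cauchy-Riemann equations, since [J_st] sends the first to the second and the second to minus the
   first. *)
have JF z w : unit_disc z -> diff_at F z (J_st w) = A (F z) *m diff_at F z w.
  move=> dz; rewrite -!differential_chart Jf//.
  apply: (@JA (set_val (f z))); first by have [] := set_valP (f z).
  rewrite -sub_tangent_space; exact: differential_tangent sf dz.
have d0 : @unit_disc R (0, 0) by rewrite unit_discE /= /sqn /= !mul0r addr0.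
have Fx0 : 'D_(plane_dir false) F (0, 0) = a^-1 *: v i.
  by rewrite -dF// -differential_chart df0.
have := disc_le sF.
have h1 z : unit_disc z -> sqdist z0 (F z) < e ^+ 2.
  by move=> _; have [] := set_valP (f z).
have h2 z : unit_disc z ->
    'D_(plane_dir true) F z = A (F z) *m 'D_(plane_dir false) F z.
  move=> dz; have := JF z (plane_dir false) dz.
  have -> : J_st (plane_dir false) = plane_dir true :> R * R.
    by rewrite /J_st /= oppr0.
  by rewrite (dF _ (plane_dir true) dz) (dF _ (plane_dir false) dz).
have h3 z : unit_disc z ->
    'D_(plane_dir false) F z = - (A (F z) *m 'D_(plane_dir true) F z).
  move=> dz; have := JF z (plane_dir true) dz.
  rewrite (dF _ (plane_dir true))// => <-.
  have -> : J_st (plane_dir true) = - plane_dir false :> R * R.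
    by rewrite /J_st /=; congr pair; rewrite oppr0.
  by rewrite -dF// /diff_at linearN opprK.
move=> /(_ h1 h2 h3); rewrite /F f0 Fx0 -/(ball_height q) => h.
have alg (x y : R) : 2 * (x * y) = a * (2 * (x * (a^-1 * y))).
  by field; rewrite gt_eqF.
have -> : dsqdist z0 (phi q) (v i) =
    a * \sum_k 2 * ((phi q k 0 - z0 k 0) * (a^-1 *: v i) k 0).
  rewrite /dsqdist mulr_sumr; apply: eq_bigr => k _; rewrite mxE.
  exact: alg.
by rewrite normrM (gtr0_norm a0); apply: ler_wpM2l => //; exact: ltW.
Qed.

Lemma kobayashi_royden_ge0 (q : N) v : (0 <= kobayashi_royden q v)%E.
Proof.
apply: le_ereal_inf_tmp => _ [a [a0 _] <-]; rewrite lee_fin; exact: ltW.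
Qed.

End ChartBall.

Section NonmeasurableMonotone.
Local Open Scope ereal_scope.
Context d (T : measurableType d) (R : realType) (mu : {measure set T -> \bar R}).

(* The integral of a nonnegative function is a supremum over simple functions
   below it, so that it is monotone even without measurability. *)
Lemma ge0_le_integral_nonmeasurable (D : set T) (f g : T -> \bar R) :
  (forall x, D x -> 0 <= f x) -> (forall x, D x -> f x <= g x) ->
  \int[mu]_(x in D) f x <= \int[mu]_(x in D) g x.
Proof.
move=> f0 fg; have g0 x : D x -> 0 <= g x.
  by move=> Dx; exact: le_trans (f0 _ Dx) (fg _ Dx).
rewrite !ge0_integralE//; apply: ge_ereal_sup => _ [h /= hf <-].
apply: ereal_sup_ubound; exists h => //= x; apply: le_trans (hf x) _.
by rewrite /patch; case: ifPn => // /set_mem; exact: fg.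
Qed.

End NonmeasurableMonotone.

(** * Integrals along piecewise smooth curves *)

Section SegmentIntegral.
Context {R : realType}.
Local Notation mu := (@lebesgue_measure R).

(** [k] dominates the derivative of [- ln (L - w) / C], so the fundamental theorem of calculus
    applies; smoothness on a larger interval gives continuity at the end points. The integral is
    over the open interval, as a curve need not have a derivative at its break points. *)
Lemma segment_integral (a b d L C : R) (w : R -> R) :
  a < b -> 0 < d -> 0 < C -> smooth_on (`]a - d, b + d[ : set R) w ->
  (forall s, w s < L) ->
  let k s := `|'D_1 w s| / (C * (L - w s)) in
  measurable_fun (`]a, b[ : set R) k /\
  (((ln (L - w a) - ln (L - w b)) / C)%:E <= \int[mu]_(s in `]a, b[) (k s)%:E)%E.
Proof.
move=> ab d0 C0 sw wL k.
set I : set R := (`]a - d, b + d[)%classic in sw.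
have Iab s : a <= s <= b -> I s.
  by move=> /andP[h1 h2]; rewrite /I /= in_itv/=; apply/andP; split; lra.
have u0 s : 0 < L - w s by rewrite subr_gt0.
have Cu0 s : 0 < C * (L - w s) by exact: mulr_gt0.
have cu s : I s -> {for s, continuous (fun s => (C * (L - w s))^-1)}.
  move=> Is; apply: cvgV; first by rewrite gt_eqF.
  apply: cvgM; first exact: cvg_cst.
  by apply: cvgB; [exact: cvg_cst|exact: (smooth_continuous sw Is)].
have cD s : I s -> {for s, continuous ('D_1 w)}.
  move=> Is; apply: smooth_continuous Is; exact: smooth_derive.
pose f s := 'D_1 w s / (C * (L - w s)).
have cf s : I s -> {for s, continuous f}.
  by move=> Is; apply: cvgM; [exact: cD|exact: cu].
have ck s : I s -> {for s, continuous k}.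
  by move=> Is; apply: cvgM; [apply: cvg_norm; exact: cD|exact: cu].
have cwf : {within `[a, b], continuous f}.
  apply: continuous_in_subspaceT => s; rewrite inE /= in_itv/=.
  by move=> /Iab; exact: cf.
have cwk : {within `[a, b], continuous k}.
  apply: continuous_in_subspaceT => s; rewrite inE /= in_itv/=.
  by move=> /Iab; exact: ck.
have mk : measurable_fun (`]a, b[ : set R) k.
  apply: open_continuous_measurable_fun; first exact: itv_open.
  move=> s; rewrite inE /= in_itv/= => /andP[h1 h2].
  by apply: ck; apply: Iab; rewrite !ltW.
split=> //.
pose F s := - (ln (L - w s) / C).
have dF s : I s -> is_derive s 1 F (f s).
  move=> Is.
  have dw : is_derive s 1 w ('D_1 w s).
    by apply: derivableP; exact: smooth_derivable sw Is.
  have dLw : is_derive s 1 (cst L - w) (- 'D_1 w s).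
    by apply: is_derive_eq; rewrite sub0r.
  have dl : is_derive ((cst L - w) s) 1 (@ln R) ((cst L - w) s)^-1.
    exact/is_derive1_ln/u0.
  have dn := is_deriveN (is_deriveZ C^-1 (is_derive1_comp dl dLw)).
  have FE : F = - (C^-1 \*: (@ln R \o (cst L - w))).
    by apply/funext => y; rewrite /F mulrC.
  have fE : f s = - (C^-1 *: ((cst L - w) s)^-1 * - 'D_1 w s).
    rewrite /f invfM mulrN opprK mulrC; congr (_ * _).
  by rewrite FE fE; apply: is_derive_eq dn _; rewrite -scalerAl.
have cF s : I s -> {for s, continuous F}.
  by move=> /dF [h _]; apply/differentiable_continuous/derivable1_diffP.
have FTC : (\int[mu]_(s in `[a, b]) (f s)%:E = (F b)%:E - (F a)%:E)%E.
  apply: continuous_FTC2 => //.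
    split.
    - move=> s; rewrite in_itv/= => /andP[h1 h2].
      have Is : I s by apply: Iab; rewrite !ltW.
      by have [] := dF _ Is.
    - by apply: cvg_at_right_filter; apply: cF; apply: Iab; rewrite lexx ltW.
    - by apply: cvg_at_left_filter; apply: cF; apply: Iab; rewrite lexx ltW.
  move=> s; rewrite in_itv/= => /andP[h1 h2].
  have Is : I s by apply: Iab; rewrite !ltW.
  by rewrite derive1E; have [_ ->] := dF _ Is.
have -> : (ln (L - w a) - ln (L - w b)) / C = F b - F a.
  by rewrite /F; ring.
rewrite EFinB -FTC -(@integral_itv_bndoo R a b (EFin \o k) true false); last exact/measurable_EFinP.
apply: le_integral; first exact: measurable_itv.
- have /= := @continuous_compact_integrable R f `[a, b] (@segment_compact R a b) cwf; exact.
- have /= := @continuous_compact_integrable R k `[a, b] (@segment_compact R a b) cwk; exact.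
- move=> s _; rewrite lee_fin /f /k; apply: ler_wpM2r; last exact: ler_norm.
  by rewrite invr_ge0 ltW.
Qed.

End SegmentIntegral.

Section Subdivision.
Context {R : realType}.
Local Notation mu := (@lebesgue_measure R).

Lemma subdivision_le (n : nat) (t : nat -> R) :
  (forall i, (i < n)%N -> t i < t i.+1) ->
  forall i j, (i <= j)%N -> (j <= n)%N -> t i <= t j.
Proof.
move=> tS i j; elim: j => [|j IH]; first by rewrite leqn0 => /eqP ->.
rewrite leq_eqVlt => /predU1P[-> //|]; rewrite ltnS => ij jn.
by apply: le_trans (ltW (tS _ jn)); apply: IH => //; exact: ltnW.
Qed.

(** [G] stands for the Kobayashi-Royden integrand, whose measurability is not assumed, so its
    integral is not split. Instead the measurable minorants [k i], extended by [0] from the disjoint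
    open pieces, are added up below [G], and the integral of this sum is split. *)
Lemma subdivision_integral_ge (n : nat) (t : nat -> R) (G : R -> \bar R)
    (k : nat -> R -> R) (c : nat -> R) :
  t 0%N = 0 -> t n = 1 -> (forall i, (i < n)%N -> t i < t i.+1) ->
  (forall s, 0 <= G s)%E ->
  (forall i, (i < n)%N -> measurable_fun (`]t i, t i.+1[ : set R) (k i)) ->
  (forall i s, (i < n)%N -> t i < s < t i.+1 -> 0 <= k i s) ->
  (forall i s, (i < n)%N -> t i < s < t i.+1 -> ((k i s)%:E <= G s)%E) ->
  (forall i, (i < n)%N ->
     ((c i)%:E <= \int[mu]_(s in `]t i, t i.+1[) (k i s)%:E)%E) ->
  ((\sum_(i < n) c i)%:E <= \int[mu]_(s in `[0%R, 1%R]) G s)%E.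
Proof.
move=> t0 tn tS G0 mk k0 kG ck.
have tle := subdivision_le tS.
pose S (i : 'I_n) : set R := (`]t i, t i.+1[)%classic.
pose f (i : 'I_n) : R -> \bar R := (EFin \o k i) \_ (S i).
have Sin (i : 'I_n) s : S i s -> t i < s < t i.+1 by rewrite /S /= in_itv.
have Ssub (i : 'I_n) : S i `<=` `[0, 1].
  move=> s /Sin /andP[h1 h2]; rewrite /= in_itv/=; apply/andP; split.
    by rewrite -t0 (le_trans _ (ltW h1))// tle// ltnW.
  by rewrite -tn (le_trans (ltW h2))// tle.
have SI (i : 'I_n) : `[0, 1] `&` S i = S i by apply: setIidr; exact: Ssub.
have f0 (i : 'I_n) s : (0 <= f i s)%E.
  rewrite /f /patch; case: ifPn => // /set_mem /Sin h; rewrite lee_fin; exact: k0.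
have mf (i : 'I_n) : measurable_fun (`[0, 1] : set R) (f i).
  apply/measurable_restrict; [exact: measurable_itv|exact: measurable_itv|].
  by rewrite SI; apply/measurable_EFinP; exact: mk.
have fG s : (\sum_(i < n) f i s <= G s)%E.
  have [[i Si]|nS] := pselect (exists i, S i s).
    have disj (j : 'I_n) : j != i -> f j s = 0%E.
      move=> ji; rewrite /f /patch; case: ifPn => // /set_mem /Sin /andP[h1 h2].
      have /andP[h3 h4] := Sin _ _ Si; exfalso.
      case: (ltngtP j i) => [ij|ij|/val_inj ij].
      - have : t j.+1 <= t i by apply: tle => //; exact: ltnW.
        by move=> h5; move: (lt_le_trans (lt_trans h3 h2) h5); rewrite ltxx.
      - have : t i.+1 <= t j by apply: tle => //; exact: ltnW.
        by move=> h5; move: (lt_le_trans (lt_trans h1 h4) h5); rewrite ltxx.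
      - by rewrite ij eqxx in ji.
    rewrite (bigD1 i)//= big1 ?adde0; last exact: disj.
    by rewrite /f /patch mem_set//=; apply: kG; [exact: ltn_ord|exact: Sin].
  rewrite big1// => i _; rewrite /f /patch; case: ifPn => // /set_mem Si.
  by exfalso; apply: nS; exists i.
apply: (@le_trans _ _ (\int[mu]_(s in `[0%R, 1%R]) \sum_(i < n) f i s)%E); last first.
  apply: ge0_le_integral_nonmeasurable => s _; last exact: fG.
  by apply: sume_ge0 => i _; exact: f0.
have f0' (i : 'I_n) s : (`[0, 1]%classic : set R) s -> (0 <= f i s)%E by move=> _; exact: f0.
have -> := @ge0_integral_sum _ _ R mu _ (measurable_itv `[0, 1]) _ f mf f0' (index_enum _).
rewrite -sumEFin; apply: lee_sum => i _.
by rewrite -integral_mkcondr SI; exact: ck.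
Qed.

End Subdivision.

(** * The logarithm of the height along curves *)

Section KobayashiLength.
Context {R : realType} (M : almostComplexManifold R).
Variables (i : chart_index M) (D0 : set M) (z0 : 'cV[R]_(2 * complex_dim M)) (e : R).
Hypotheses (oD0 : open D0) (D0i : D0 `<=` chart_dom i).
Variables (C : R) (C0 : 0 < C).

Local Notation oU := (open_chart_ball z0 e oD0 D0i).
Local Notation N := (open_submanifold oU).
Local Notation phi q := (chart_map i (set_val q : M)).
Local Notation height := (@ball_height R M i D0 z0 e oD0 D0i).

Hypothesis royden_ge : forall (q : N) v,
  ((`|dsqdist z0 (phi q) (v i)| / (C * height q))%:E <= kobayashi_royden q v)%E.

(** The bounds on the pieces of the subdivision telescope to the total variation of [ln (height)]
    between the end points of the curve, in the sense of a signed difference. *)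
Lemma kobayashi_length_ge (gamma : R -> N) : piecewise_smooth gamma ->
  (((ln (height (gamma 0)) - ln (height (gamma 1))) / C)%:E
     <= kobayashi_length gamma)%E.
Proof.
move=> [_ [n [t [t0 tn tS]]]].
have u0 q : 0 < height q by exact: ball_height_gt0.
pose k s := `|dsqdist z0 (phi (gamma s)) (differential gamma s 1 i)|
  / (C * height (gamma s)).
have seg j : (j < n)%N -> measurable_fun (`]t j, t j.+1[ : set R) k /\
    ((((ln (height (gamma (t j))) - ln (height (gamma (t j.+1)))) / C)%:E) <=
      \int[lebesgue_measure]_(s in `]t j, t j.+1[) (k s)%:E)%E.
  move=> /tS [tj [d [g [d0 sg gE]]]].
  pose I : set R := (`]t j - d, t j.+1 + d[)%classic.
  have oI : open I by exact: itv_open.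
  pose c s := phi (g s).
  have sc : smooth_on I c by exact: smooth_map_chart.
  pose w s := sqdist z0 (c s).
  have sw : smooth_on I w by exact: smooth_sqdist_comp.
  have we s : w s < e ^+ 2 by rewrite -subr_gt0; exact: (u0 (g s)).
  have [mk' ik'] := segment_integral tj d0 C0 sw we.
  (* Strictly inside a piece [gamma] agrees with its smooth extension [g] in a neighbourhood, so
     their differentials agree; at the break points only the values do. *)
  have kE s : t j < s < t j.+1 -> `|'D_1 w s| / (C * (e ^+ 2 - w s)) = k s.
    move=> sj; have /andP[h1 h2] := sj.
    have Is : I s.
      by rewrite /I /= in_itv/=; apply/andP; split; lra.
    have near_g : \forall y \near s, c y = phi (gamma y).
      have : nbhs s (`]t j, t j.+1[)%classic.
        by apply: open_nbhs_nbhs; split; [exact: itv_open|rewrite /= in_itv].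
      apply: filterS => y; rewrite /= in_itv/= => /andP[y1 y2].
      by rewrite gE// !ltW.
    have gs : gamma s = g s by rewrite gE// !ltW.
    have dc : differentiable c s by exact: smooth_differentiable sc Is.
    rewrite /k differential_chart -(near_eq_diff_at (1 : R) near_g dc) gs.
    rewrite /diff_at -deriveE// (derive_sqdist_comp z0 oI sc (1 : R) Is).
    by [].
  split.
    apply: eq_measurable_fun mk' => s; rewrite inE /= in_itv/=; exact: kE.
  have E : (\int[lebesgue_measure]_(s in `]t j, t j.+1[)
      (`|'D_1 w s| / (C * (e ^+ 2 - w s)))%:E =
      \int[lebesgue_measure]_(s in `]t j, t j.+1[) (k s)%:E)%E.
    by apply: eq_integral => s; rewrite inE /= in_itv/= => sj; congr (_%:E); exact: kE.
  have tj1 : t j <= t j <= t j.+1 by rewrite lexx ltW.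
  have tj2 : t j <= t j.+1 <= t j.+1 by rewrite lexx andbT ltW.
  rewrite -E (gE _ tj1) (gE _ tj2).
  exact: ik'.
pose c j := (ln (height (gamma (t j))) - ln (height (gamma (t j.+1)))) / C.
have -> : (ln (height (gamma 0)) - ln (height (gamma 1))) / C = \sum_(j < n) c j.
  have tele (F : nat -> R) l : \sum_(j < l) (F j - F j.+1) = F 0%N - F l.
    elim: l => [|l IH]; first by rewrite big_ord0 subrr.
    by rewrite big_ord_recr/= IH addrA subrK.
  rewrite -mulr_suml (tele (fun j => ln (height (gamma (t j))))).
  by rewrite t0 tn.
apply: (@subdivision_integral_ge R n t _ (fun=> k) c t0 tn).
- by move=> j /tS [].
- by move=> s; exact: kobayashi_royden_ge0.
- by move=> j /seg [].
- by move=> j s _ _; rewrite /k divr_ge0// ltW// mulr_gt0.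
- by move=> j s _ _; exact: royden_ge.
- by move=> j /seg [].
Qed.

(** A distance below [r] is witnessed by a curve of length below [r], along which [ln (height)]
    drops by less than [C * r]; exponentiating gives the claim. *)
Lemma height_ge_of_kobayashi_dist (p q : N) (r : R) :
  (kobayashi_dist p q < r%:E)%E -> height p * expR (- (C * r)) <= height q.
Proof.
move=> /ereal_inf_lt [_ [gamma [pg g0 g1] <-] lr].
have := le_lt_trans (kobayashi_length_ge pg) lr; rewrite lte_fin g0 g1 => h.
have u0 x : 0 < height x by exact: ball_height_gt0.
have h1 : ln (height p) - C * r <= ln (height q).
  by move: h; rewrite ltr_pdivrMr// (mulrC r) => h; lra.
rewrite -[leRHS]lnK ?posrE// -[X in X * _]lnK ?posrE// -expRD.
by rewrite ler_expR.
Qed.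

End KobayashiLength.

(** * Completeness *)

Section CompactBall.
Context {R : realType} {m : nat}.

Lemma mx_entry_le_norm (p q : nat) (A : 'M[R]_(p, q)) i j : `|A i j| <= `|A|.
Proof.
rewrite [leRHS]/Num.Def.normr/= mx_normrE.
exact: (le_bigmax _ (fun ij : 'I_p * 'I_q => `|A ij.1 ij.2|) (i, j)).
Qed.

Lemma mx_norm_le (p q : nat) (A : 'M[R]_(p, q)) (c : R) : 0 <= c ->
  (forall i j, `|A i j| <= c) -> `|A| <= c.
Proof.
move=> c0 Ac; rewrite [leLHS]/Num.Def.normr/= mx_normrE.
by apply: bigmax_le => // -[i j] _; exact: Ac.
Qed.

Lemma continuous_trmx : continuous (trmx : 'rV[R]_m -> 'cV[R]_m).
Proof.
move=> v B /nbhs_ballP[e /= e0 eB]; apply/nbhs_ballP; exists e => //= x [_ vx].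
by apply: eB; split=> // i j; rewrite !mxE; exact: vx.
Qed.

Lemma compact_sqdist_le (z0 : 'cV[R]_m) (c : R) : 0 <= c ->
  compact [set w | sqdist z0 w <= c].
Proof.
move=> c0.
have cs : continuous (fun v : 'rV[R]_m => sqdist z0 v^T).
  by move=> v; apply: continuous_comp; [exact: continuous_trmx|exact: continuous_sqdist].
(* Transposition moves the set to row vectors, where [bounded_closed_compact] applies. *)
have -> : [set w | sqdist z0 w <= c] =
    trmx @` [set v : 'rV[R]_m | sqdist z0 v^T <= c].
  apply/seteqP; split=> [w wc|_ [v vc <-]//].
  by exists w^T; rewrite /= trmxK.
apply: continuous_compact; first exact/continuous_subspaceT/continuous_trmx.
apply: bounded_closed_compact; last first.
  rewrite (_ : [set v | _] = (fun v : 'rV[R]_m => sqdist z0 v^T) @^-1` [set x | x <= c])//.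
  by apply: preimage_closed => [v _|]; [exact: cs|exact: closed_le].
exists (1 + c + `|z0|); split=> [|y /ltW cy v /= vc]; first exact: num_real.
apply: le_trans cy; apply: mx_norm_le => [|i j].
  by rewrite !addr_ge0.
have h : `|v i j - z0 j 0| <= 1 + c.
  have : (v i j - z0 j 0) ^+ 2 <= c.
    have := @ler_term_sum R m (fun k => (v^T k 0 - z0 k 0) ^+ 2) j
      (fun k => sqr_ge0 _).
    by rewrite mxE (ord1 i) => /le_trans; apply.
  move: (v i j - _) => x xc; rewrite ler_norml; apply/andP; split; nra.
rewrite -(subrK (z0 j 0) (v i j)); apply: le_trans (ler_normD _ _) (lerD h _).
exact: mx_entry_le_norm.
Qed.

End CompactBall.

Section CompleteBall.
Context {R : realType} (M : almostComplexManifold R).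
Variables (i : chart_index M) (D0 : set M) (z0 : 'cV[R]_(2 * complex_dim M)) (e : R).
Hypotheses (oD0 : open D0) (D0i : D0 `<=` chart_dom i).

Local Notation oU := (open_chart_ball z0 e oD0 D0i).
Local Notation N := (open_submanifold oU).
Local Notation phi q := (chart_map i (set_val q : M)).
Local Notation height := (@ball_height R M i D0 z0 e oD0 D0i).

Hypothesis ball_sub : forall w, sqdist z0 w < e ^+ 2 -> (chart_map i @` D0) w.

Lemma chart_ball_surj w : sqdist z0 w < e ^+ 2 -> exists q : N, phi q = w.
Proof.
move=> we; have [x D0x xw] := ball_sub we.
have Ux : (chart_ball i D0 z0 e) x by split => //=; rewrite xw.
by exists (SigSub (mem_set Ux)).
Qed.

(** The set is the image of a closed Euclidean ball under the inverse chart. By [ball_sub] the chart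
    is onto the open ball of radius [e], and [d > 0] keeps the closed ball inside it. *)
Lemma compact_height_ge (d : R) : 0 < d -> compact [set q : N | d <= height q].
Proof.
(* For [d > e ^+ 2] the set is empty; otherwise the centre [z0] lies in the ball and provides the
   default point [q0] of the inverse chart. *)
move=> d0; have [dE|dE] := ltP (e ^+ 2) d.
  rewrite (_ : [set q : N | _] = set0); first exact: compact0.
  rewrite -subset0 => q /= dq; have h : height q <= e ^+ 2.
    by rewrite /ball_height gerBl; apply: sumr_ge0 => k _; exact: sqr_ge0.
  by move: (le_lt_trans (le_trans dq h) dE); rewrite ltxx.
have z00 : sqdist z0 z0 < e ^+ 2.
  rewrite /sqdist big1 => [|k _]; last by rewrite subrr expr0n.
  exact: lt_le_trans d0 dE.
have [q0 _] := chart_ball_surj z00.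
pose psi w : N := if pselect (exists q : N, phi q = w) is left h
  then projT1 (cid h) else q0.
have psiK (q : N) : psi (phi q) = q.
  rewrite /psi; case: pselect => [h|]; last by case; exists q.
  case: (cid h) => q' /= e'.
  by apply: (@chart_inj _ _ N i q' q); [exact: ball_dom|exact: ball_dom|].
(* Continuity of the inverse is openness of the chart map. *)
have cpsi (q : N) : {for phi q, continuous psi}.
  move=> B nB; have : nbhs q B := eq_ind _ (fun x => nbhs x B) nB _ (psiK q).
  rewrite nbhsE => -[B' [oB' B'q] B'B].
  have : nbhs (phi q) ((fun q : N => phi q) @` B').
    apply: open_nbhs_nbhs; split; last by exists q.
    by apply: (@chart_open _ _ N i B' oB') => x _; exact: ball_dom.
  by apply: filterS => _ [x B'x <-] /=; rewrite /= psiK; exact: B'B.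
have -> : [set q : N | d <= height q] = psi @` [set w | sqdist z0 w <= e ^+ 2 - d].
  apply/seteqP; split=> [q /= dq|_ [w /= wd <-]].
    by exists (phi q); [rewrite /= lerBrDr addrC -lerBrDr|exact: psiK].
  have we : sqdist z0 w < e ^+ 2 by apply: le_lt_trans wd _; rewrite gtrBl.
  have [q qw] := chart_ball_surj we; rewrite -qw psiK.
  by rewrite /ball_height qw lerBrDr addrC -lerBrDr.
apply: continuous_compact; last by apply: compact_sqdist_le; rewrite subr_ge0.
apply: continuous_in_subspaceT => w; rewrite inE /= => wd.
have we : sqdist z0 w < e ^+ 2 by apply: le_lt_trans wd _; rewrite gtrBl.
by have [q <-] := chart_ball_surj we; exact: cpsi.
Qed.

Variable C : R.
Hypothesis dist_ge : forall (p q : N) (r : R), (kobayashi_dist p q < r%:E)%E ->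
  height p * expR (- (C * r)) <= height q.

(** By [dist_ge] a Kobayashi ball lies in a superlevel set of the height with positive level, which
    is compact, hence closed in a Hausdorff space, and so contains the closure of the ball. *)
Lemma complete_chart_ball : complete_hyperbolic N.
Proof.
move=> p r _.
have d0 : 0 < height p * expR (- (C * r)).
  by rewrite mulr_gt0 ?expR_gt0//; exact: ball_height_gt0.
have cL := compact_height_ge d0.
have clL := compact_closed (@manifold_hausdorff _ _ N) cL.
apply: subclosed_compact cL _; first exact: closed_closure.
rewrite [X in _ `<=` X](_ : _ = closure [set q : N | height p * expR (- (C * r)) <= height q]).
  by apply: closureS => q; exact: dist_ge.
by apply/closure_id.
Qed.

End CompleteBall.

Theorem corollary1 (R : realType) (M : almostComplexManifold R) (p : M)
    (W : set M) (hW : nbhs p W) :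
  exists (U : set M) (oU : open U),
    [/\ U p, U `<=` W & complete_hyperbolic (open_submanifold oU)].
Proof.
have [i ip] := @chart_cover _ _ M p.
(* Shrinking the chart domain to the interior of [W] places every chart ball inside [W], and keeps
   the domain open. *)
pose D0 : set M := chart_dom i `&` interior W.
have oD0 : open D0 by apply: openI; [exact: chart_dom_open|exact: open_interior].
have D0i : D0 `<=` chart_dom i by move=> q [].
have D0p : D0 p by split.
have [A [sA JA]] := @acJ_smooth _ M i.
pose A' := chart_rep (chart_dom i) (chart_map i) A.
have oO : open (chart_map i @` D0) by exact: chart_open.
have sA' : smooth_on (chart_map i @` D0) A'.
  by apply: smooth_on_sub_eq sA => //; exact: image_subset.
have Op : (chart_map i @` D0) (chart_map i p) by exists p.
have [e e0 /(_ e)] := disc_estimate oO sA' Op.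
rewrite e0 lexx => /(_ isT) [ball_sub [C C0 disc_le]].
exists (chart_ball i D0 (chart_map i p) e), (open_chart_ball _ e oD0 D0i); split.
- split=> //=; rewrite /sqdist big1 => [|k _]; last by rewrite subrr expr0n.
  exact: exprn_gt0.
- by move=> q [[_ /interior_subset]].
have JA' (q : M) v : D0 q -> tangent_space q v ->
    acJ q v i = A' (chart_map i q) *m v i.
  move=> Dq vq; have iq := D0i _ Dq.
  by rewrite (JA q v iq vq) /A' chart_repE//; exact: chart_inj.
have royden_ge := kobayashi_royden_ge (oD0 := oD0) (D0i := D0i) JA' C0 disc_le.
have dist_ge := height_ge_of_kobayashi_dist C0 royden_ge.
exact (complete_chart_ball ball_sub dist_ge).
Qed.
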